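(* Let $(\mathcal{A},\gamma,\mathbb{T})$ be a full $C^*$-dynamical system with $\mathcal{A}$ unital, and assume that the fixed point algebra $\mathcal{A}^0$ has a tracial state. Let $s':\mathcal{T}(\mathcal{A}^0)\to\mathcal{T}(\mathcal{A}^0)$ be the associated invertible operator $s'(\tau)(a)=\tau\big(\sum_j x_j^*ax_j\big)$. Then $r_{\min}(s')$ and $r_{\max}(s')$ are eigenvalues of $s'$ with corresponding tracial state eigenvectors; that is, there are tracial states $\tau_{1},\tau_{2}$ on $\mathcal{A}^0$ with $s'(\tau_1)=r_{\min}(s')\tau_1$ and $s'(\tau_2)=r_{\max}(s')\tau_2$.
   Context: $\gamma$ is a (strongly continuous) action of the circle $\mathbb{T}$ on $\mathcal{A}$ by $*$-automorphisms. For $k\in\mathbb{Z}$, $\mathcal{A}^k=\{a\in\mathcal{A}:\gamma_z(a)=z^ka\ \forall z\in\mathbb{T}\}$. The system is full if for every $k\in\mathbb{Z}$ the closed linear span of $\{xy:x\in\mathcal{A}^k,y\in\mathcal{A}^{-k}\}$ equals $\mathcal{A}^0$. $\mathcal{T}(\mathcal{A}^0)\subset(\mathcal{A}^0)^*$ is the Banach space of bounded trace functionals ($\tau(ab)=\tau(ba)$) on $\mathcal{A}^0$. By fullness there are finite subsets $\{y_i\},\{x_j\}\subset\mathcal{A}^1$ with $\sum_iy_i^*y_i=I$ and $\sum_jx_jx_j^*=I$. The operator $s'$ on $\mathcal{T}(\mathcal{A}^0)$, $s'(\tau)(a)=\tau(\sum_jx_j^*ax_j)$, does not depend on the choice of $\{x_j\}$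 and is invertible, with inverse $t'(\tau)(a)=\tau(\sum_iy_iay_i^* )$. $\sigma(s')$ denotes the spectrum of $s'$, $r_{\max}(s')=\max\{|\lambda|:\lambda\in\sigma(s')\}$ and $r_{\min}(s')=\min\{|\lambda|:\lambda\in\sigma(s')\}$. *)

(* Defs.v *)
From HB Require Import structures.
From mathcomp Require Import all_boot all_order all_algebra.
From mathcomp Require Import complex.
From mathcomp Require Import boolp classical_sets functions reals topology.
From mathcomp Require Import normedtype.

Set Implicit Arguments.
Unset Strict Implicit.
Unset Printing Implicit Defensive.

Import Order.TTheory GRing.Theory Num.Theory.
Import numFieldNormedType.Exports.

Local Open Scope classical_set_scope.
Local Open Scope ring_scope.
Local Open Scope complex_scope.

(* The norm is a field of the structure, rather than inherited from
   normedModType, because Hierarchy Builder already joins rings and normed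
   Z-modules at numDomainType and rejects any other join of the two.
   Completeness is kept apart so that the fixed-point algebra below, whose
   completeness is a theorem, can carry the same structure. *)
HB.mixin Record Algebra_isPreCStar (R : realType) A
    of GRing.Algebra R[i] A := {
  star : A -> A;
  starK : involutive star;
  starD : {morph star : a b / a + b};
  starZ : forall (c : R[i]) (a : A), star (c *: a) = c^* *: star a;
  starM : forall a b : A, star (a * b) = star b * star a;
  cnorm : A -> R;
  cnormD_le : forall a b : A, cnorm (a + b) <= cnorm a + cnorm b;
  cnormZ : forall (c : R[i]) (a : A), cnorm (c *: a) = Normc.normc c * cnorm a;
  cnorm0_eq0 : forall a : A, cnorm a = 0 -> a = 0;
  cnormM_le : forall a b : A, cnorm (a * b) <= cnorm a * cnorm b;
  cnorm_starM : forall a : A, cnorm (star a * a) = cnorm a ^+ 2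
}.

#[short(type="preCStarAlgType")]
HB.structure Definition PreCStarAlgebra (R : realType) :=
  {A of GRing.Algebra R[i] A & Algebra_isPreCStar R A}.

(* A with the normed module structure given by cnorm. *)
Definition normed_space (R : realType) (A : preCStarAlgType R) : Type := A.

Section NormedSpace.
Variables (R : realType) (A : preCStarAlgType R).
Let norm (a : normed_space A) : R[i] := (cnorm (a : A))%:C.
HB.instance Definition _ := GRing.Lmodule.on (normed_space A).
Let normD (a b : normed_space A) : norm (a + b) <= norm a + norm b.
Proof. by rewrite /norm -rmorphD/= lecR; exact: cnormD_le. Qed.
Let normZ (c : R[i]) (a : normed_space A) : norm (c *: a) = `|c| * norm a.
Proof. by rewrite /norm cnormZ rmorphM. Qed.
Let norm0 (a : normed_space A) : norm a = 0 -> a = 0.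
Proof. by move=> /complexI; exact: cnorm0_eq0. Qed.
HB.instance Definition _ :=
  Lmodule_isNormed.Build R[i] (normed_space A) normD normZ norm0.
End NormedSpace.

Section CnormFacts.
Variables (R : realType) (A : preCStarAlgType R).
Implicit Types a b : A.

Lemma normc_ge0 (c : R[i]) : 0 <= Normc.normc c.
Proof. by case: c => x y; exact: sqrtr_ge0. Qed.

Lemma cnorm0 : cnorm (0 : A) = 0.
Proof. by rewrite -(scale0r (0 : A)) cnormZ Normc.normc0 mul0r. Qed.

Lemma cnorm_ge0 a : 0 <= cnorm a.
Proof.
have : cnorm (a + -1 *: a) <= cnorm a + cnorm (-1 *: a) by exact: cnormD_le.
rewrite scaleN1r subrr cnorm0 -scaleN1r cnormZ normcN Normc.normc1 mul1r.
by rewrite -mulr2n pmulrn_lge0.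
Qed.

End CnormFacts.

HB.mixin Record PreCStar_isCStar (R : realType) A of PreCStarAlgebra R A := {
  cstar_complete : forall F : set_system (normed_space A),
    ProperFilter F -> cauchy F -> cvg F
}.

#[short(type="cstarAlgType")]
HB.structure Definition CStarAlgebra (R : realType) :=
  {A of PreCStarAlgebra R A & PreCStar_isCStar R A}.

HB.instance Definition _ (R : realType) (A : cstarAlgType R) :=
  Uniform_isComplete.Build (normed_space A) (@cstar_complete R A).

Section Span.
Variables (K : numFieldType) (V : lmodType K).

Definition lin_span (S : set V) : set V :=
  [set v | exists (n : nat) (c : 'I_n -> K) (u : 'I_n -> V),
     (forall i, S (u i)) /\ v = \sum_(i < n) c i *: u i].

End Span.

Section Spectrum.
Variables (K : numFieldType) (V : normedModType K).

Definition resolvent_set (s : V -> V) : set K :=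
  [set l | exists2 r : {linear V -> V}, continuous r &
     cancel (fun v => s v - l *: v) r /\ cancel r (fun v => s v - l *: v)].

Definition spectrum (s : V -> V) : set K := ~` resolvent_set s.

Definition spectral_moduli (s : V -> V) : set K :=
  [set `|l| | l in spectrum s].

Definition is_rmax (s : V -> V) (r : K) : Prop :=
  spectral_moduli s r /\ forall x, spectral_moduli s x -> x <= r.

Definition is_rmin (s : V -> V) (r : K) : Prop :=
  spectral_moduli s r /\ forall x, spectral_moduli s x -> r <= x.

End Spectrum.

Section TraceSpace.
Variables (R : realType) (B : preCStarAlgType R).

Definition bounded_trace (f : B -> R[i]^o) : Prop :=
  [/\ linear f,
      exists M : R, forall a, Normc.normc (f a) <= M * cnorm a
    & forall a b, f (a * b) = f (b * a)].

Definition trace_space : Type :=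
  set_type (bounded_trace : set (B -> R[i]^o)).

HB.instance Definition _ := SubChoice.on trace_space.

Definition trace_fun (t : trace_space) : B -> R[i]^o := val t.
Coercion trace_fun : trace_space >-> Funclass.

Lemma trace_spaceP (t : trace_space) : bounded_trace t.
Proof. exact: (set_mem (valP t)). Qed.

Lemma bounded_trace_submod_closed :
  submod_closed (mem (bounded_trace : set (B -> R[i]^o))).
Proof.
split=> [|c f g]; rewrite !inE.
  split=> [k x y||//].
    by rewrite /= scaler0 addr0.
  by exists 0 => a; rewrite mul0r Normc.normc0.
move=> [fl [M Mf] ft] [gl [N Ng] gt]; split=> [k x y||x y].
- rewrite !fctE fl gl !scalerDr !scalerA addrACA.
  by rewrite [c * k]mulrC.
- exists (Normc.normc c * M + N) => a.
  rewrite !fctE (le_trans (le_normcD _ _))// mulrDl lerD//.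
  rewrite Normc.normcM -mulrA ler_wpM2l//.
  exact: normc_ge0.
- by rewrite !fctE ft gt.
Qed.

HB.instance Definition _ :=
  GRing.SubChoice_isSubLmodule.Build R[i] (B -> R[i]^o) _ trace_space
    bounded_trace_submod_closed.

Definition trace_norm (t : trace_space) : R :=
  sup [set Normc.normc (t b) | b in [set b : B | cnorm b <= 1]].

Let ballT (t : trace_space) :=
  [set Normc.normc (t b) | b in [set b : B | cnorm b <= 1]].

Lemma trace_fun_linear (t : trace_space) : linear t.
Proof. by case: (trace_spaceP t). Qed.

HB.instance Definition _ (t : trace_space) :=
  GRing.isLinear.Build R[i] B R[i]^o *:%R t (trace_fun_linear t).
Let ballT_sup t : has_sup (ballT t).
Proof.
split; first by exists (Normc.normc (t 0)), 0 => //=; rewrite cnorm0.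
have [_ [M tM] _] := trace_spaceP t.
exists `|M| => _ [b /= b1 <-].
rewrite (le_trans (tM b))// (le_trans (y := `|M| * cnorm b))//.
  by rewrite ler_wpM2r ?cnorm_ge0 ?ler_norm.
by rewrite ler_piMr.
Qed.

Let trace_norm_ub (t : trace_space) (b : B) : cnorm b <= 1 -> Normc.normc (t b) <= trace_norm t.
Proof. by move=> b1; apply: ub_le_sup; [case: (ballT_sup t)|exists b]. Qed.

Let trace_norm_le (t : trace_space) (M : R) :
  (forall b, cnorm b <= 1 -> Normc.normc (t b) <= M) -> trace_norm t <= M.
Proof.
move=> tM; apply: ge_sup; first by case: (ballT_sup t).
by move=> _ [b /= b1 <-]; exact: tM.
Qed.

Let trace_normD (s t : trace_space) : trace_norm (s + t) <= trace_norm s + trace_norm t.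
Proof.
apply: trace_norm_le => b b1; rewrite (le_trans (le_normcD _ _))//.
by rewrite lerD// trace_norm_ub.
Qed.

Let trace_normZ_le (c : R[i]) (t : trace_space) :
  trace_norm (c *: t) <= Normc.normc c * trace_norm t.
Proof.
apply: trace_norm_le => b b1; rewrite [X in Normc.normc X]/(c * t b).
by rewrite Normc.normcM ler_wpM2l ?normc_ge0 ?trace_norm_ub.
Qed.

Let trace_normZ (c : R[i]) (t : trace_space) :
  trace_norm (c *: t) = Normc.normc c * trace_norm t.
Proof.
apply/eqP; rewrite eq_le trace_normZ_le/=.
have [->|c0] := eqVneq c 0.
  rewrite Normc.normc0 mul0r.
  rewrite (le_trans (normc_ge0 ((0 *: t : trace_space) 0)))//.
  by rewrite trace_norm_ub ?cnorm0.
have nc0 : 0 < Normc.normc c.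
  rewrite lt_neqAle normc_ge0 andbT eq_sym.
  by apply: contra_neq c0 => /Normc.eq0_normc.
rewrite -ler_pdivlMl// -Normc.normcV.
by rewrite -{1}[t](scalerK c0) trace_normZ_le.
Qed.

Let trace_norm0 (t : trace_space) : trace_norm t = 0 -> t = 0.
Proof.
move=> t0; apply/val_inj/funext => b; apply: Normc.eq0_normc.
have tb0 x : cnorm x <= 1 -> Normc.normc (t x) = 0.
  move=> x1; apply/eqP; rewrite eq_le normc_ge0 andbT -t0.
  exact: trace_norm_ub.
have [->|b0] := eqVneq b 0; first by apply: tb0; rewrite cnorm0.
have nb : cnorm b != 0 by apply: contra_neq b0; exact: cnorm0_eq0.
have cb : (cnorm b)%:C != 0 :> R[i] by apply: contra_neq nb => /complexI.
rewrite -[b in val t b](scalerKV cb) -/(trace_fun t) linearZ/=.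
rewrite [_ *: _]/(_ * _) Normc.normcM (tb0 (_ *: b)) ?mulr0//.
rewrite cnormZ Normc.normcV [Normc.normc _]/= expr0n addr0 sqrtr_sqr.
by rewrite ger0_norm ?cnorm_ge0// mulVf.
Qed.

Let trace_cnorm (t : trace_space) : R[i] := (trace_norm t)%:C.
Let trace_cnormD s t : trace_cnorm (s + t) <= trace_cnorm s + trace_cnorm t.
Proof. by rewrite /trace_cnorm -rmorphD/= lecR. Qed.
Let trace_cnormZ (c : R[i]) t : trace_cnorm (c *: t) = `|c| * trace_cnorm t.
Proof. by rewrite /trace_cnorm trace_normZ rmorphM. Qed.
Let trace_cnorm0 t : trace_cnorm t = 0 -> t = 0.
Proof. by move=> /complexI; exact: trace_norm0. Qed.

HB.instance Definition _ := Lmodule_isNormed.Build R[i] trace_space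
  trace_cnormD trace_cnormZ trace_cnorm0.

Definition tracial_state (t : trace_space) : Prop :=
  (forall a : B, 0 <= t (star a * a)) /\ t 1 = 1.

End TraceSpace.

(* Only the values of the action at complex numbers of modulus 1 matter.
   Bijectivity of each circ_act z follows from the group law. *)
Record circle_action (R : realType) (A : cstarAlgType R) := CircleAction {
  circ_act :> R[i] -> A -> A;
  circ_act1 : forall a, circ_act 1 a = a;
  circ_actM : forall z w a, `|z| = 1 -> `|w| = 1 ->
    circ_act (z * w) a = circ_act z (circ_act w a);
  circ_act_linear : forall z, `|z| = 1 -> linear (circ_act z);
  circ_act_mul : forall z, `|z| = 1 -> {morph circ_act z : a b / a * b};
  circ_act_star : forall z, `|z| = 1 -> {morph circ_act z : a / star a};
  circ_act_continuous : forall a : A,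
    {within [set z : R[i]^o | `|z| = 1],
      continuous (fun z : R[i]^o => circ_act z a : normed_space A)}
}.

Section CircleAction.
Variables (R : realType) (A : cstarAlgType R) (g : circle_action A).

Definition spectral_subspace (k : int) : set A :=
  [set a | forall z : R[i], `|z| = 1 -> g z a = z ^ k *: a].

Definition full : Prop := forall k : int,
  closure (lin_span [set x * y | x in spectral_subspace k
                               & y in spectral_subspace (- k)]
           : set (normed_space A))
  = spectral_subspace 0.

Definition fixed_alg : Type := set_type (spectral_subspace 0).

HB.instance Definition _ := SubChoice.on fixed_alg.

Let unit_neq0 (z : R[i]) : `|z| = 1 -> z != 0.
Proof. by move=> z1; rewrite -normr_eq0 z1 oner_eq0. Qed.

Let circ_act_1 z : `|z| = 1 -> g z 1 = 1.
Proof.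
move=> z1; have zV1 : `|z^-1| = 1 by rewrite normfV z1 invr1.
have gK : g z (g z^-1 1) = 1.
  by rewrite -circ_actM// divff ?unit_neq0// circ_act1.
by rewrite -[RHS]gK -[g z^-1 1 in RHS]mul1r circ_act_mul// gK mulr1.
Qed.

Lemma fixed_alg_subalg_closed : subalg_closed (mem (spectral_subspace 0)).
Proof.
split=> [|c a b|a b]; rewrite !inE.
- by move=> z z1; rewrite expr0z scale1r circ_act_1.
- by move=> ha hb z z1; rewrite circ_act_linear// ha// hb// !expr0z !scale1r.
- by move=> ha hb z z1; rewrite circ_act_mul// ha// hb// !expr0z !scale1r.
Qed.

HB.instance Definition _ :=
  GRing.SubChoice_isSubAlgebra.Build R[i] A _ fixed_alg
    fixed_alg_subalg_closed.

Definition fixed_val (a : fixed_alg) : A := val a.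

Definition Sub_fixed (a : A) (ha : spectral_subspace 0 a) : fixed_alg :=
  exist (fun x => x \in spectral_subspace 0) a (mem_set ha).

Lemma fixed_val_inj : injective fixed_val.
Proof. exact: val_inj. Qed.

Lemma fixed_valP (a : fixed_alg) : spectral_subspace 0 (fixed_val a).
Proof. exact: (set_mem (valP a)). Qed.

Lemma fixed_val_linear : linear fixed_val.
Proof. by []. Qed.

HB.instance Definition _ :=
  GRing.isLinear.Build R[i] fixed_alg A *:%R fixed_val fixed_val_linear.

Lemma fixed_val1 : fixed_val 1 = 1.
Proof. by []. Qed.

Lemma fixed_valM : {morph fixed_val : a b / a * b}.
Proof. by []. Qed.

Let fixed_star_subproof (a : fixed_alg) :
  spectral_subspace 0 (star (fixed_val a)).
Proof.
by move=> z z1; rewrite circ_act_star// fixed_valP// expr0z !scale1r.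
Qed.
Let fixed_star (a : fixed_alg) : fixed_alg := Sub_fixed (fixed_star_subproof a).
Let fixed_norm (a : fixed_alg) : R := cnorm (fixed_val a).

Let fixed_starK : involutive fixed_star.
Proof. by move=> a; apply/fixed_val_inj/starK. Qed.
Let fixed_starD : {morph fixed_star : a b / a + b}.
Proof. by move=> a b; apply/fixed_val_inj/starD. Qed.
Let fixed_starZ (c : R[i]) a : fixed_star (c *: a) = c^* *: fixed_star a.
Proof. by apply/fixed_val_inj/starZ. Qed.
Let fixed_starM a b : fixed_star (a * b) = fixed_star b * fixed_star a.
Proof. by apply/fixed_val_inj/starM. Qed.
Let fixed_normD a b : fixed_norm (a + b) <= fixed_norm a + fixed_norm b.
Proof. exact: cnormD_le. Qed.
Let fixed_normZ (c : R[i]) a :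
  fixed_norm (c *: a) = Normc.normc c * fixed_norm a.
Proof. exact: cnormZ. Qed.
Let fixed_norm0 a : fixed_norm a = 0 -> a = 0.
Proof. by move=> /cnorm0_eq0 a0; apply: fixed_val_inj. Qed.
Let fixed_normM a b : fixed_norm (a * b) <= fixed_norm a * fixed_norm b.
Proof. exact: cnormM_le. Qed.
Let fixed_norm_starM a : fixed_norm (fixed_star a * a) = fixed_norm a ^+ 2.
Proof. exact: cnorm_starM. Qed.

HB.instance Definition _ := Algebra_isPreCStar.Build R fixed_alg
  fixed_starK fixed_starD fixed_starZ fixed_starM fixed_normD fixed_normZ
  fixed_norm0 fixed_normM fixed_norm_starM.

Lemma fixed_val_star : {morph fixed_val : a / star a}.
Proof. by []. Qed.

Lemma fixed_cnormE (a : fixed_alg) : cnorm a = cnorm (fixed_val a).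
Proof. by []. Qed.

Definition row_family (xs : seq A) : Prop :=
  (forall x, x \in xs -> spectral_subspace 1 x) /\
  \sum_(x <- xs) x * star x = 1.

Section DualShift.
Variables (xs : seq A) (hxs : row_family xs).

Let entry_subproof x y (a : fixed_alg) : x \in xs -> y \in xs ->
  spectral_subspace 0 (star x * fixed_val a * y).
Proof.
have [xs1 _] := hxs; move=> /xs1 x1 /xs1 y1 z z1.
rewrite !circ_act_mul// circ_act_star// x1// y1// fixed_valP//.
rewrite expr0z !scale1r expr1z starZ -!scalerAl -scalerAr scalerA mulrC.
by rewrite -sqr_normc z1 expr1n scale1r.
Qed.

Let entry x y (a : fixed_alg) : fixed_alg :=
  insubd (0 : fixed_alg) (star x * fixed_val a * y).

Let val_entry x y a : x \in xs -> y \in xs ->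
  fixed_val (entry x y a) = star x * fixed_val a * y.
Proof.
by move=> xxs yxs; apply: insubdK; apply: mem_set; exact: entry_subproof.
Qed.

Lemma compression_subproof (a : fixed_alg) :
  spectral_subspace 0 (\sum_(x <- xs) star x * fixed_val a * x).
Proof.
rewrite big_seq (eq_bigr (fun x => fixed_val (entry x x a))).
  by rewrite -raddf_sum; exact: fixed_valP.
by move=> x xxs; rewrite val_entry.
Qed.

Definition compression (a : fixed_alg) : fixed_alg :=
  Sub_fixed (compression_subproof a).

Lemma fixed_val_compression (a : fixed_alg) :
  fixed_val (compression a) = \sum_(x <- xs) star x * fixed_val a * x.
Proof. by []. Qed.

Let compressionE a : compression a = \sum_(x <- xs) entry x x a.
Proof.
apply: fixed_val_inj; rewrite fixed_val_compression raddf_sum.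
by rewrite big_seq [RHS]big_seq; apply: eq_bigr => x xxs; exact/esym/val_entry.
Qed.

Let entryM x y a b : x \in xs -> y \in xs ->
  entry x y (a * b) = \sum_(z <- xs) entry x z a * entry z y b.
Proof.
move=> xxs yxs; apply: fixed_val_inj; rewrite val_entry// raddf_sum.
transitivity (star x * fixed_val a * (\sum_(z <- xs) z * star z)
              * (fixed_val b * y)).
  by case: hxs => _ ->; rewrite mulr1 fixed_valM !mulrA.
rewrite mulr_sumr mulr_suml big_seq [RHS]big_seq.
apply: eq_bigr => z zxs; rewrite [RHS](fixed_valM (entry x z a)).
by rewrite !val_entry// !mulrA.
Qed.

Lemma dual_shift_subproof (t : trace_space fixed_alg) :
  bounded_trace (fun a => t (compression a)).
Proof.
have [tl [M tM] tt] := trace_spaceP t; split.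
- move=> c a b; rewrite -tl; congr (t _); apply: fixed_val_inj.
  rewrite fixed_val_linear !fixed_val_compression scaler_sumr -big_split.
  apply: eq_bigr => x _; rewrite fixed_val_linear.
  by rewrite mulrDr mulrDl -scalerAr -scalerAl.
- exists (`|M| * \sum_(x <- xs) cnorm (star x) * cnorm x) => a.
  rewrite (le_trans (tM _))// (le_trans (y := `|M| * cnorm (compression a)))//.
    by rewrite ler_wpM2r ?cnorm_ge0 ?ler_norm.
  rewrite -mulrA ler_wpM2l// !fixed_cnormE fixed_val_compression.
  elim: (xs) => [|x s IH]; first by rewrite !big_nil cnorm0 mul0r.
  rewrite !big_cons mulrDl (le_trans (cnormD_le _ _))// lerD//.
  rewrite (le_trans (cnormM_le _ _))// mulrAC ler_wpM2r ?cnorm_ge0//.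
  exact: cnormM_le.
- move=> a b; rewrite !compressionE.
  rewrite !(raddf_sum t) big_seq [RHS]big_seq.
  under eq_bigr => x xxs do rewrite entryM// (raddf_sum t).
  under [RHS]eq_bigr => x xxs do rewrite entryM// (raddf_sum t).
  rewrite -!big_seq exchange_big.
  by apply: eq_bigr => x _; apply: eq_bigr => y _; exact: tt.
Qed.

(* The operator tau |-> (a |-> tau (\sum_j x_j^* a x_j)) on the traces of the
   fixed-point algebra. *)
Definition dual_shift (t : trace_space fixed_alg) : trace_space fixed_alg :=
  exist (fun f => f \in _) _ (mem_set (dual_shift_subproof t)).

Lemma dual_shiftE (t : trace_space fixed_alg) (a : fixed_alg) :
  dual_shift t a = t (compression a).
Proof. by []. Qed.

End DualShift.

End CircleAction.

(* Main.v *)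
(* Positive elements of a C*-algebra are handled through square roots given by a
   convergent iteration, without spectral theory.  A bounded trace is a
   combination of four positive traces of controlled mass, so the growth of the
   iterates [s^n] of the shift on all bounded traces is governed by the masses
   [s^n tau (1)] of positive traces [tau].  Let [r] be the infimum of the [rho]
   for which these masses are [O(rho ^ n)].  Outside the disc of radius [r] the
   Neumann series inverts [s - l].  As [lam] decreases to [r], the positive
   resolvent at [lam] cannot stay bounded on tracial states, so its normalised
   values are approximate eigenvectors, and a limit along an ultrafilter is a
   tracial state with eigenvalue [r].  Hence [r = r_max].
   By fullness a positive element dominating 1 is a sum of [x x^*] with [x] in
   [A^k]; normalising it by its inverse square root produces the families
   [{x_j}] (for [k = 1]) and [{y_i^*}] (for [k = -1]).  The latter defines the
   inverse shift, whose growth rate is [1 / r_min]. *)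

Require Import Defs.
From HB Require Import structures.
From mathcomp Require Import all_boot all_order all_algebra.
From mathcomp Require Import complex.
From mathcomp Require Import boolp classical_sets functions reals topology.
From mathcomp Require Import normedtype.
From mathcomp Require Import ring lra.

Import Order.TTheory GRing.Theory Num.Theory.
Import numFieldNormedType.Exports.

Local Open Scope classical_set_scope.
Local Open Scope ring_scope.

Set Implicit Arguments.
Unset Strict Implicit.
Unset Printing Implicit Defensive.

(** * Norm limits and square roots *)

(** The shift is not assumed compact, so operator theory alone does not make its spectral radius an
    eigenvalue. Positivity fills the gap: on positive traces the additive functional [mass] controls
    the norm up to a constant, so normalised approximate eigenvectors are bounded at each element,
    and a pointwise limit keeps the value 1 at the unit and cannot vanish. Pointwise limits suffice
    because the shift only evaluates a trace at another element, [S t a = t (phi a)]. Traces live on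
    the fixed-point algebra, whose completeness follows from contractivity of the action, itself a
    positivity argument in [A]. Hence positivity is developed for every [cauchy_complete] algebra
    and used in both. The compressions by a frame of degree 1 and one of degree -1 need not be
    inverse to each other on the algebra; they become inverse under a trace, where factors of degree
    0 may be cycled. The tracial state keeps the trace space from being zero, and thereby makes both
    growth rates positive. *)

Section Basics.
Context {R : realType} {A : preCStarAlgType R}.
Implicit Types (a b c x y : A) (r : R).
Local Open Scope complex_scope.

Lemma star0 : star (0 : A) = 0.
Proof. by apply: (addrI (star 0)); rewrite -starD !addr0. Qed.

Lemma starN a : star (- a) = - star a.
Proof. by apply: (addrI (star a)); rewrite -starD !subrr star0. Qed.

Lemma starB a b : star (a - b) = star a - star b.
Proof. by rewrite starD starN. Qed.

Lemma star1 : star (1 : A) = 1.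
Proof. by rewrite -[LHS]mul1r -[X in X * _]starK -starM mul1r starK. Qed.

Lemma starZr r a : star (r%:C *: a) = r%:C *: star a.
Proof. by rewrite starZ; congr (_ *: _); exact: conjc_real. Qed.

Lemma star_sum I (s : seq I) (F : I -> A) :
  star (\sum_(i <- s) F i) = \sum_(i <- s) star (F i).
Proof. by apply: big_morph; [exact: starD|exact: star0]. Qed.

Lemma normcr r : Normc.normc r%:C = `|r|.
Proof. by rewrite /= expr0n addr0 sqrtr_sqr. Qed.

Lemma cnormZr r a : 0 <= r -> cnorm (r%:C *: a) = r * cnorm a.
Proof. by move=> r0; rewrite cnormZ normcr ger0_norm. Qed.

Lemma cnormN a : cnorm (- a) = cnorm a.
Proof. by rewrite -scaleN1r cnormZ normcN Normc.normc1 mul1r. Qed.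

Lemma cnorm_distC a b : cnorm (a - b) = cnorm (b - a).
Proof. by rewrite -cnormN opprB. Qed.

Lemma cnorm_star a : cnorm (star a) = cnorm a.
Proof.
have le b : cnorm b <= cnorm (star b).
  have [->|b0] := eqVneq b 0; first by rewrite star0.
  have nb : 0 < cnorm b.
    by rewrite lt_neqAle cnorm_ge0 andbT eq_sym; apply: contra_neq b0 => /cnorm0_eq0.
  by rewrite -(ler_pM2r nb) -expr2 -cnorm_starM cnormM_le.
by apply/eqP; rewrite eq_le le andbT -{2}[a]starK le.
Qed.

Lemma cnorm1_le : cnorm (1 : A) <= 1.
Proof.
have := cnorm_starM (1 : A); rewrite star1 mulr1 => e.
have := cnorm_ge0 (1 : A); nra.
Qed.

Lemma cnorm_sum I (s : seq I) (F : I -> A) :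
  cnorm (\sum_(i <- s) F i) <= \sum_(i <- s) cnorm (F i).
Proof.
elim: s => [|i s IH]; first by rewrite !big_nil cnorm0.
by rewrite !big_cons (le_trans (cnormD_le _ _))// lerD2l.
Qed.

Lemma cnormX_le a n : cnorm (a ^+ n) <= cnorm a ^+ n.
Proof.
elim: n => [|n IH]; first by rewrite !expr0 cnorm1_le.
by rewrite !exprS (le_trans (cnormM_le _ _))// ler_wpM2l ?cnorm_ge0.
Qed.

Definition cto (u : nat -> A) a : Prop :=
  forall e : R, 0 < e -> exists N, forall n, (N <= n)%N -> cnorm (u n - a) <= e.

Lemma cto_uniq u a b : cto u a -> cto u b -> a = b.
Proof.
move=> ua ub; apply/eqP; rewrite -subr_eq0; apply/eqP/cnorm0_eq0/eqP.
rewrite eq_le cnorm_ge0 andbT leNgt; apply/negP => d0.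
have d3 : 0 < cnorm (a - b) / 3 by rewrite divr_gt0.
have [N HN] := ua _ d3; have [M HM] := ub _ d3.
have := HN _ (leq_maxl N M); have := HM _ (leq_maxr N M).
rewrite [cnorm (_ - a)]cnorm_distC.
have := cnormD_le (a - u (maxn N M)) (u (maxn N M) - b).
rewrite addrA subrK; lra.
Qed.

Lemma ctoD u v a b : cto u a -> cto v b -> cto (fun n => u n + v n) (a + b).
Proof.
move=> ua vb e e0; have e2 : 0 < e / 2 by rewrite divr_gt0.
have [N HN] := ua _ e2; have [M HM] := vb _ e2.
exists (maxn N M) => n; rewrite geq_max => /andP[/HN h1 /HM h2].
rewrite opprD addrACA (le_trans (cnormD_le _ _))//; lra.
Qed.

Lemma cto_cst a : cto (fun=> a) a.
Proof. by move=> e e0; exists 0%N => n _; rewrite subrr cnorm0 ltW. Qed.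

Lemma ctoZ k u a : cto u a -> cto (fun n => k *: u n) (k *: a).
Proof.
move=> ua e e0.
have k0 : 0 < Normc.normc k + 1 by rewrite ltr_wpDl// normc_ge0.
have [N HN] := ua _ (divr_gt0 e0 k0).
exists N => n /HN; rewrite -scalerBr cnormZ ler_pdivlMr// => h.
rewrite (le_trans _ h)// mulrC ler_wpM2l ?cnorm_ge0//; lra.
Qed.

Lemma cto_bounded u a : cto u a ->
  exists N, forall n, (N <= n)%N -> cnorm (u n) <= cnorm a + 1.
Proof.
move=> /(_ _ ltr01) [N HN]; exists N => n /HN h.
by rewrite -[u n](subrK a) (le_trans (cnormD_le _ _))// addrC lerD2l.
Qed.

Lemma ctoM u v a b : cto u a -> cto v b -> cto (fun n => u n * v n) (a * b).
Proof.
move=> ua vb e e0.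
have [K HK] := cto_bounded ua.
have a0 := cnorm_ge0 a; have b0 := cnorm_ge0 b.
set d := cnorm a + cnorm b + 1; have d0 : 0 < d by rewrite /d; lra.
have ed : 0 < e / (2 * d) by rewrite divr_gt0// mulr_gt0.
have [N HN] := ua _ ed; have [M HM] := vb _ ed.
exists (maxn K (maxn N M)) => n.
rewrite !geq_max => /and3P[/HK h0 /HN h1 /HM h2].
rewrite -[u n * v n](subrK (u n * b)) -addrA -mulrBr -mulrBl.
rewrite (le_trans (cnormD_le _ _))//.
rewrite (_ : e = d * (e / (2 * d)) + e / (2 * d) * d); last first.
  by field; rewrite gt_eqF.
have e'0 := ltW ed.
apply: lerD; rewrite (le_trans (cnormM_le _ _))//.
  by rewrite ler_pM ?cnorm_ge0// (le_trans h0)// /d; lra.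
by rewrite ler_pM ?cnorm_ge0// /d; lra.
Qed.

Lemma cto_star u a : cto u a -> cto (fun n => star (u n)) (star a).
Proof.
move=> ua e e0; have [N HN] := ua _ e0.
by exists N => n /HN; rewrite -starB cnorm_star.
Qed.

Lemma cto_shift u a : cto u a -> cto (fun n => u n.+1) a.
Proof.
by move=> ua e e0; have [N HN] := ua _ e0; exists N => n Nn; apply/HN/leqW.
Qed.

Lemma cto_norm_le u a r : cto u a -> (forall n, cnorm (u n) <= r) -> cnorm a <= r.
Proof.
move=> ua ur; rewrite leNgt; apply/negP => ra.
have d2 : 0 < (cnorm a - r) / 2 by rewrite divr_gt0// subr_gt0.
have [N /(_ _ (leqnn N))] := ua _ d2; rewrite cnorm_distC => h.
have := cnormD_le (a - u N) (u N); rewrite subrK; have := ur N; lra.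
Qed.

End Basics.

(** A predicate on [preCStarAlgType], so that it can be proved for [fixed_alg g] as well as for
    [A]. *)
Definition cauchy_complete (R : realType) (A : preCStarAlgType R) : Prop :=
  forall u : nat -> A,
    (forall e : R, 0 < e -> exists N, forall m n, (N <= m)%N -> (N <= n)%N ->
      cnorm (u m - u n) <= e) ->
    exists a, cto u a.

Section Complete.
Context {R : realType} {A : preCStarAlgType R}.
Hypothesis Ac : cauchy_complete A.
Implicit Types (a b c x y : A) (r : R).
Local Open Scope complex_scope.

(** Summing increments, [u] moves no further than the nondecreasing bounded sequence [s]. The scalar
    iteration behind [one_sub_sqrt] tends to 1 without a geometric rate, so this comparison takes
    the place of a geometric estimate. *)
Lemma dominated_cvg (u : nat -> A) (s : nat -> R) r :
  (forall n, cnorm (u n.+1 - u n) <= s n.+1 - s n) -> (forall n, s n <= r) ->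
  exists a, cto u a.
Proof.
move=> us sr; apply: Ac => e e0.
have us' m k : cnorm (u (m + k)%N - u m) <= s (m + k)%N - s m.
  elim: k => [|k IH]; first by rewrite addn0 !subrr cnorm0.
  rewrite addnS -[_ - u m](subrKA (u (m + k)%N)).
  rewrite (le_trans (cnormD_le _ _))//; have := us (m + k)%N; lra.
have smono m n : (m <= n)%N -> s m <= s n.
  move=> /subnKC <-; rewrite -subr_ge0.
  exact: le_trans (cnorm_ge0 _) (us' _ _).
pose S := [set s n | n in setT].
have hS : has_sup S.
  by split; [exists (s 0%N), 0%N|exists r => _ [n _ <-]].
have [_ [N _ <-] hN] := sup_adherent (divr_gt0 e0 (ltr0n R 2)) hS.
have key n : (N <= n)%N -> cnorm (u n - u N) <= e / 2.
  move=> Nn; have := us' N (n - N)%N; rewrite subnKC// => /le_trans-> //.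
  have : s n <= sup S by apply: ub_le_sup; [case: hS|exists n].
  lra.
exists N => m n /key hm /key; rewrite cnorm_distC => hn.
rewrite -[u m - _](subrKA (u N)) (le_trans (cnormD_le _ _))//; lra.
Qed.

Lemma one_sub_invertible x : cnorm x < 1 ->
  exists2 y, (1 - x) * y = 1 & y * (1 - x) = 1.
Proof.
move=> x1; set q := cnorm x; have q0 : 0 <= q := cnorm_ge0 x.
pose u n := \sum_(i < n) x ^+ i; pose s n := \sum_(i < n) q ^+ i.
have sE n : s n = (1 - q ^+ n) / (1 - q).
  apply: (canRL (mulfK _)); first by rewrite subr_eq0 gt_eqF.
  elim: n => [|n IH]; first by rewrite /s big_ord0 mul0r expr0 subrr.
  by rewrite /s big_ord_recr/= mulrDl -/(s n) IH exprSr; ring.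
have qn n : 0 <= q ^+ n by rewrite exprn_ge0.
have [y uy] : exists y, cto u y.
  apply: (@dominated_cvg _ s (1 - q)^-1) => n.
    rewrite /u /s !big_ord_recr/= [X in cnorm X]addrC [leRHS]addrC !addKr.
    exact: cnormX_le.
  by rewrite sE ler_piMl ?invr_ge0 ?subr_ge0 ?(ltW x1)// gerBl.
have un n : u n.+1 = 1 + x * u n.
  by rewrite /u big_ord_recl expr0 mulr_sumr; congr (_ + _);
     apply: eq_bigr => i _; rewrite exprS.
have un' n : u n.+1 = 1 + u n * x.
  by rewrite /u big_ord_recl expr0 mulr_suml; congr (_ + _);
     apply: eq_bigr => i _; rewrite exprSr.
have e1 : y = 1 + x * y.
  apply: cto_uniq (cto_shift uy) _.
  under [X in cto X]funext do rewrite un.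
  exact: ctoD (cto_cst _) (ctoM (cto_cst _) uy).
have e2 : y = 1 + y * x.
  apply: cto_uniq (cto_shift uy) _.
  under [X in cto X]funext do rewrite un'.
  exact: ctoD (cto_cst _) (ctoM uy (cto_cst _)).
exists y.
  by rewrite mulrBl mul1r {1}e1 addrK.
by rewrite mulrBr mulr1 {1}e2 addrK.
Qed.

(* [y] is the limit of the iteration [y := (x + y ^+ 2) / 2]; its increments are
   dominated by those of the scalar iteration started with [x = 1]. *)
Lemma one_sub_sqrt x : star x = x -> cnorm x <= 1 ->
  exists y, [/\ star y = y, cnorm y <= 1, (1 - y) * (1 - y) = 1 - x
              & forall c, c * x = x * c -> c * y = y * c].
Proof.
move=> xh x1.
pose u := fix u n := if n is n'.+1 then 2^-1%:C *: (x + u n' * u n') else 0 : A.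
pose s := fix s n := if n is n'.+1 then 2^-1 * (1 + s n' * s n') else 0 : R.
have s01 n : 0 <= s n <= 1.
  by elim: n => [|n /andP[h1 h2]] /=; [rewrite lexx ler01|apply/andP; split; nra].
have uh n : star (u n) = u n.
  by elim: n => [|n IH] /=; [exact: star0|rewrite starZr starD starM IH xh].
have ucomm c n : c * x = x * c -> c * u n = u n * c.
  move=> cx; elim: n => [|n IH] /=; first by rewrite mulr0 mul0r.
  rewrite -scalerAr -scalerAl mulrDr mulrDl cx; congr (_ *: (_ + _)).
  by rewrite mulrA IH -mulrA IH mulrA.
have uu n m : u n * u m = u m * u n.
  exact: (ucomm _ _ (esym (ucomm _ _ erefl))).
have us n : cnorm (u n) <= s n.
  elim: n => [|n IH]; first by rewrite /= cnorm0.
  rewrite [u _]/= [s _]/= cnormZr ?invr_ge0// ler_wpM2l ?invr_ge0//.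
  rewrite (le_trans (cnormD_le _ _))// lerD// (le_trans (cnormM_le _ _))//.
  by rewrite ler_pM ?cnorm_ge0.
have dus n : cnorm (u n.+1 - u n) <= s n.+1 - s n.
  elim: n => [|n IH]; first by rewrite subr0 [s 0%N]/= subr0; exact: us.
  rewrite [u n.+2]/= [X in _ - X]/= [s n.+2]/= [X in _ - X]/=.
  rewrite -scalerBr -mulrBr cnormZr ?invr_ge0// ler_wpM2l ?invr_ge0//.
  rewrite -/(u n.+1) -/(s n.+1) [x + _]addrC addrKA [1 + _]addrC addrKA.
  (* All iterates commute, so the difference of squares factors as it does for scalars. *)
  have -> : u n.+1 * u n.+1 - u n * u n = (u n.+1 - u n) * (u n.+1 + u n).
    by rewrite mulrBl !mulrDr [u n * u n.+1]uu addrKA.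
  have -> : s n.+1 * s n.+1 - s n * s n = (s n.+1 - s n) * (s n.+1 + s n) by ring.
  rewrite (le_trans (cnormM_le _ _))// ler_pM ?cnorm_ge0//.
  by rewrite (le_trans (cnormD_le _ _))// lerD.
have [y uy] : exists y, cto u y.
  by apply: (@dominated_cvg _ s 1) => // n; case/andP: (s01 n).
have ye : y = 2^-1%:C *: (x + y * y).
  apply: cto_uniq (cto_shift uy) _.
  exact: ctoZ (ctoD (cto_cst _) (ctoM uy uy)).
exists y; split.
- apply: cto_uniq (cto_star uy) _.
  by under [X in cto X]funext do rewrite uh.
- by apply: (cto_norm_le uy) => n; rewrite (le_trans (us n))//; case/andP: (s01 n).
- have y2 : y + y = x + y * y.
    rewrite {1 2}ye -scalerDl -rmorphD /=.
    by rewrite (_ : 2^-1 + 2^-1 = 1) ?scale1r//; lra.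
  have yy : y * y = y + y - x by rewrite y2 addrC addKr.
  by rewrite mulrBl mul1r mulrBr mulr1 yy opprB [y + y - x - y]addrAC addrK subrKA.
- move=> c cx; apply: cto_uniq (ctoM (cto_cst _) uy) _.
  under [X in cto X]funext do rewrite (ucomm _ _ cx).
  exact: ctoM uy (cto_cst _).
Qed.

End Complete.

(** * Positive elements *)

(* Positivity without spectra: [a] is hermitian and lies in a ball of radius [c]
   around the scalar [c]. *)
Definition pos (R : realType) (A : preCStarAlgType R) (a : A) : Prop :=
  star a = a /\ exists2 c : R, 0 <= c & cnorm (c%:C%C%:A - a) <= c.

Section Positive.
Context {R : realType} {A : preCStarAlgType R}.
Implicit Types (a b k x y : A) (r c : R).
Local Open Scope complex_scope.

Lemma pos_herm a : pos a -> star a = a.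
Proof. by case. Qed.

Lemma pos0 : pos (0 : A).
Proof. by split; [exact: star0|exists 0 => //; rewrite scale0r subr0 cnorm0]. Qed.

Lemma posD a b : pos a -> pos b -> pos (a + b).
Proof.
move=> [ah [c c0 ac]] [bh [d d0 bd]]; split; first by rewrite starD ah bh.
exists (c + d); first exact: addr_ge0.
rewrite rmorphD scalerDl opprD addrACA (le_trans (cnormD_le _ _))//; exact: lerD.
Qed.

Lemma posZ r a : 0 <= r -> pos a -> pos (r%:C *: a).
Proof.
move=> r0 [ah [c c0 ac]]; split; first by rewrite starZr ah.
exists (r * c); first exact: mulr_ge0.
by rewrite rmorphM -scalerA -scalerBr cnormZr// ler_wpM2l.
Qed.

Lemma pos_sum I (s : seq I) (F : I -> A) :
  (forall i, pos (F i)) -> pos (\sum_(i <- s) F i).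
Proof. by move=> F0; apply: big_ind => //; [exact: pos0|exact: posD]. Qed.

Lemma star_scalar r : star (r%:C%:A : A) = r%:C%:A.
Proof. by rewrite starZr star1. Qed.

Lemma pos_scalar r : 0 <= r -> pos (r%:C%:A : A).
Proof.
by move=> r0; split; [exact: star_scalar|exists r; rewrite ?subrr ?cnorm0].
Qed.

Lemma pos1 : pos (1 : A).
Proof. by have := pos_scalar ler01; rewrite scale1r. Qed.

Lemma pos_scalarB a r : star a = a -> cnorm a <= r -> pos (r%:C%:A - a).
Proof.
move=> ah ar; split; first by rewrite starB star_scalar ah.
by exists r; [exact: le_trans (cnorm_ge0 _) ar|rewrite opprB addrC subrK].
Qed.

Lemma pos_scalarD a r : star a = a -> cnorm a <= r -> pos (r%:C%:A + a).
Proof.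
move=> ah ar; rewrite -[a]opprK; apply: pos_scalarB; last by rewrite cnormN.
by rewrite starN ah.
Qed.

Lemma starZi a : star ('i *: a) = - ('i *: star a).
Proof.
rewrite starZ -scaleNr; congr (_ *: _).
by apply/eqP; rewrite eq_complex /= !oppr0 !eqxx.
Qed.

Lemma half_double a : 2^-1%:C *: (a + a) = a.
Proof.
rewrite scalerDr -scalerDl -rmorphD /=.
by rewrite (_ : 2^-1 + 2^-1 = 1) ?scale1r//; lra.
Qed.

Lemma complex_iM : 'i * 'i = -1 :> R[i].
Proof. by rewrite -expr2 sqr_i. Qed.

Lemma normci : Normc.normc ('i : R[i]) = 1.
Proof. by rewrite /= expr0n expr1n add0r sqrtr1. Qed.

(* [a + 'i b] is unitary, hence of norm at most 1. *)
Lemma herm_circle_le1 a b : star a = a -> star b = b -> a * b = b * a ->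
  a * a + b * b = 1 -> cnorm a <= 1.
Proof.
move=> ah bh ab ab1; pose u := a + 'i *: b.
have su : star u = a - 'i *: b by rewrite starD starZi ah bh.
have uu : star u * u = 1.
  rewrite su /u mulrDr !mulrBl -!scalerAl -!scalerAr ab scalerA.
  rewrite complex_iM scaleN1r opprK -ab1.
  by rewrite addrA subrK.
have u1 : cnorm u <= 1.
  have := cnorm_starM u; rewrite uu => e.
  have := @cnorm1_le R A; have := cnorm_ge0 u; nra.
have := cnormD_le u (star u); rewrite cnorm_star.
have -> : u + star u = 2%:C *: a.
  by rewrite su /u addrACA subrr addr0 rmorphMn/= scaler_nat mulr2n.
rewrite cnormZr//; lra.
Qed.

End Positive.

(** * Square roots and the positivity of [star x * x] *)

Section PositiveComplete.
Context {R : realType} {A : preCStarAlgType R}.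
Hypothesis Ac : cauchy_complete A.
Implicit Types (a b k x y : A) (r c : R).
Local Open Scope complex_scope.

(** If [a] is within [c] of the scalar [c > 0], then [a = c (1 - x)] with [x] of norm at most 1, and
    [sqrt c] times the root of [1 - x] works. The commutation clause stands in for functional
    calculus. *)
Lemma pos_sqrt a : pos a ->
  exists k, [/\ pos k, k * k = a & forall b, b * a = a * b -> b * k = k * b].
Proof.
move=> [ah [c]]; rewrite le_eqVlt => /predU1P[<-|c0] ac.
  exists 0; split; [exact: pos0| |by move=> b _; rewrite mulr0 mul0r].
  rewrite mulr0; apply/esym/cnorm0_eq0/eqP; rewrite eq_le cnorm_ge0 andbT.
  by move: ac; rewrite scale0r sub0r cnormN.
have cV : 0 <= c^-1 by rewrite invr_ge0 ltW.
pose x := 1 - c^-1%:C *: a.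
have ccK (b : A) : c^-1%:C *: (c%:C *: b) = b.
  by rewrite scalerA -rmorphM mulVf ?gt_eqF// scale1r.
have ccK' (b : A) : c%:C *: (c^-1%:C *: b) = b.
  by rewrite scalerA -rmorphM mulfV ?gt_eqF// scale1r.
have x1 : cnorm x <= 1.
  rewrite /x -[X in X - _]ccK -scalerBr cnormZr// mulrC ler_pdivrMr// mul1r//.
have xh : star x = x by rewrite starB star1 starZr ah.
have [y [yh y1 yx yc]] := one_sub_sqrt Ac xh x1.
pose s := Num.sqrt c; have s0 : 0 <= s := sqrtr_ge0 c.
exists (s%:C *: (1 - y)); split.
- split; first by rewrite starZr starB star1 yh.
  exists s => //; rewrite -scalerBr opprB [X in _ *: X]addrC subrK cnormZr//.
  by rewrite ler_piMr.
- rewrite -scalerAl -scalerAr yx scalerA -rmorphM -expr2 sqr_sqrtr ?(ltW c0)//.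
  by rewrite /x opprB [X in _ *: X]addrC subrK ccK'.
- move=> b ba; rewrite -scalerAr -scalerAl mulrBr mulrBl mulr1 mul1r yc//.
  by rewrite /x mulrBr mulrBl mulr1 mul1r -scalerAr -scalerAl ba.
Qed.

(** Scale [a] to a contraction [b]; the added 1 in [n] avoids division by zero. The root [w] of
    [1 - b * b] satisfies [b * b + w * w = 1], so [herm_circle_le1] gives [cnorm w <= 1], and
    [1 - b * b = w * w] has norm at most 1. *)
Lemma sqr_pos a : star a = a -> pos (a * a).
Proof.
move=> ah; set n := cnorm a + 1.
have n0 : 0 < n by rewrite /n ltr_wpDl ?cnorm_ge0.
pose b := n^-1%:C *: a.
have nV : 0 <= n^-1 by rewrite invr_ge0 ltW.
have bh : star b = b by rewrite starZr ah.
have b1 : cnorm b <= 1.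
  by rewrite cnormZr// mulrC ler_pdivrMr// mul1r /n lerDl.
have bb1 : cnorm (b * b) <= 1.
  by rewrite (le_trans (cnormM_le _ _))// mulr_ile1 ?cnorm_ge0.
have bbh : star (b * b) = b * b by rewrite starM bh.
have [y [yh _ yy yc]] := one_sub_sqrt Ac bbh bb1.
have w1 : cnorm (1 - y) <= 1.
  apply: (@herm_circle_le1 _ _ _ b); rewrite ?bh ?starB ?star1 ?yh//.
    by rewrite mulrBr mulrBl mulr1 mul1r yc// mulrA.
  by rewrite yy subrK.
have bbp : pos (b * b).
  split=> //; exists 1 => //; rewrite scale1r -yy (le_trans (cnormM_le _ _))//.
  by rewrite mulr_ile1 ?cnorm_ge0.
have -> : a * a = (n * n)%:C *: (b * b).
  have an : a = n%:C *: b by rewrite scalerA -rmorphM mulfV ?gt_eqF// scale1r.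
  by rewrite {1 2}an -scalerAl -scalerAr scalerA -rmorphM.
by apply: posZ => //; rewrite mulr_ge0// ltW.
Qed.

(** The commutation clause of [pos_sqrt], applied twice, makes the roots [k] and [l] commute, and
    the product is the square of the hermitian [k * l]. *)
Lemma pos_mul_comm a b : pos a -> pos b -> a * b = b * a -> pos (a * b).
Proof.
move=> /pos_sqrt[k [kp <- kc]] /pos_sqrt[l [lp <- lc]] kl2.
have kl : l * k = k * l by apply: kc; apply/esym/lc.
have -> : k * k * (l * l) = (k * l) * (k * l).
  by rewrite -!mulrA; congr (_ * _); rewrite !mulrA kl.
by apply: sqr_pos; rewrite starM !pos_herm.
Qed.

(** After division by [d = c + e], which is positive even for [c = 0], take roots [k] of [1 - b] and
    [l] of [1 + b]. They commute, so [(k l)^2 + b^2 = 1] and [herm_circle_le1] applies. *)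
Lemma cnorm_le_of_pos a c : 0 <= c -> star a = a ->
  pos (c%:C%:A - a) -> pos (c%:C%:A + a) -> cnorm a <= c.
Proof.
move=> c0 ah pa pa'; apply/ler_addgt0Pr => e e0.
have d0 : 0 < c + e by rewrite ltr_wpDl.
pose d := c + e; pose b := d^-1%:C *: a.
have dV : 0 <= d^-1 by rewrite invr_ge0 ltW.
have bh : star b = b by rewrite starZr ah.
have d1 : d^-1%:C *: (d%:C%:A) = 1 :> A.
  by rewrite scalerA -rmorphM mulVf ?gt_eqF// scale1r.
have pb : pos (1 - b).
  rewrite -d1 -scalerBr; apply: posZ => //; rewrite rmorphD scalerDl addrAC.
  by apply: posD => //; apply/pos_scalar/ltW.
have pb' : pos (1 + b).
  rewrite -d1 -scalerDr; apply: posZ => //; rewrite rmorphD scalerDl addrAC.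
  by apply: posD => //; apply/pos_scalar/ltW.
have [k [kp kk kc]] := pos_sqrt pb; have [l [lp ll lc]] := pos_sqrt pb'.
have bk : b * k = k * b by apply: kc; rewrite mulrBr mulrBl mulr1 mul1r.
have bl : b * l = l * b by apply: lc; rewrite mulrDr mulrDl mulr1 mul1r.
have kl : k * l = l * k by apply: lc; rewrite mulrDr mulrDl mulr1 mul1r bk.
have : cnorm b <= 1.
  apply: (@herm_circle_le1 _ _ _ (k * l)) => //.
  - by rewrite starM !pos_herm.
  - by rewrite mulrA bk -mulrA bl mulrA.
  - have -> : k * l * (k * l) = (k * k) * (l * l).
      by rewrite -!mulrA; congr (_ * _); rewrite !mulrA kl.
    rewrite kk ll mulrBl mul1r mulrDr mulr1 addrKA.
    by rewrite addrC subrK.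
by rewrite cnormZr// mulrC ler_pdivrMr// mul1r.
Qed.

Lemma pos_cnorm_le a c : 0 <= c -> pos a -> pos (c%:C%:A - a) -> cnorm a <= c.
Proof.
move=> c0 pa pca; apply: cnorm_le_of_pos => //; first exact: pos_herm.
by apply: posD => //; exact: pos_scalar.
Qed.

Lemma pos_anti a : pos a -> pos (- a) -> a = 0.
Proof.
move=> pa pna; apply/cnorm0_eq0/eqP; rewrite eq_le cnorm_ge0 andbT.
by apply: pos_cnorm_le => //; rewrite scale0r sub0r.
Qed.

(** Here [u] and [v] are twice the real and imaginary parts of [y], and
    [u^2 + v^2 = 2 (y * star y + star y * y)]. *)
Lemma mul_star_pos_of_neg y : pos (- (star y * y)) -> pos (y * star y).
Proof.
move=> py.
pose u := y + star y; pose v := 'i *: (star y - y).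
have uh : star u = u by rewrite starD starK addrC.
have vh : star v = v by rewrite starZi starB starK -scalerN opprB.
have e : y * star y + y * star y = u * u + v * v + 
    (- (star y * y) + - (star y * y)).
  rewrite /v -scalerAl -scalerAr scalerA complex_iM scaleN1r /u.
  rewrite mulrBl !mulrBr mulrDl !mulrDr.
  set p := y * y; set q := y * star y; set r := star y * y; set s := star y * star y.
  rewrite !opprD !opprK.
  rewrite !addrA addrK [RHS](ACl (2*5*1*6*3*7*4*8)%AC)/= !addrK.
  by [].
have : pos (2^-1%:C *: (y * star y + y * star y)).
  apply: posZ; first by rewrite invr_ge0.
  rewrite e; apply: posD; last exact: posD.
  by apply: posD; exact: sqr_pos.
by rewrite half_double.
Qed.

(* Applying [mul_star_pos_of_neg] to [y] and to [y * k], where [k * k] is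
   [- (star y * y)], makes [(y * star y) ^+ 2] both positive and negative. *)
Lemma neg_star_mul_eq0 y : pos (- (star y * y)) -> y = 0.
Proof.
move=> py; have pyy := mul_star_pos_of_neg py.
have [k [kp kk kc]] := pos_sqrt py.
have zz : star (y * k) * (y * k) = - ((star y * y) * (star y * y)).
  rewrite starM (pos_herm kp) mulrA -(mulrA k) -kc; last by rewrite mulrN mulNr.
  by rewrite -mulrA kk mulrN.
have pz : pos (y * k * star (y * k)).
  apply: mul_star_pos_of_neg; rewrite zz opprK.
  by apply: sqr_pos; rewrite starM starK.
have z0 : y * k * star (y * k) = - ((y * star y) * (y * star y)).
  have -> : y * k * star (y * k) = y * (k * k) * star y.
    by rewrite starM (pos_herm kp) !mulrA.
  by rewrite kk mulrN mulNr !mulrA.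
have b0 : y * star y * (y * star y) = 0.
  apply: pos_anti; last by rewrite -z0.
  by apply: sqr_pos; rewrite starM starK.
apply: cnorm0_eq0; apply/eqP.
have bh : star (y * star y) = y * star y by rewrite starM starK.
have := cnorm_starM (y * star y); rewrite bh b0 cnorm0 => /esym/eqP.
rewrite expf_eq0/=; rewrite -{1}[y]starK cnorm_starM expf_eq0/=.
by rewrite cnorm_star.
Qed.

(** With [p] the absolute value of [a], the element [m = p - a] is twice the negative part. Then
    [star (x m) * (x m) = m a m = - (m p m)] is negative, so [x m = 0] by [neg_star_mul_eq0]. Hence
    [a m = p m = 0], so [m^2 = 0] and [a = p]. *)
Lemma star_mul_pos x : pos (star x * x).
Proof.
set a := star x * x.
have ah : star a = a by rewrite starM starK.
have [p [pp paa pc]] := pos_sqrt (sqr_pos ah).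
have ap : a * p = p * a by apply: pc; rewrite mulrA.
pose m := p - a.
have mh : star m = m by rewrite starB ah pos_herm.
have am : a * m = - (p * m) .
  by rewrite !mulrBr -paa -ap opprB.
have mp : p * m = m * p by rewrite mulrBl mulrBr ap.
have xm : x * m = 0.
  apply: neg_star_mul_eq0.
  rewrite starM mh mulrA -(mulrA m) -/a -mulrA am mulrN opprK mp mulrA.
  by apply: pos_mul_comm => //; [exact: sqr_pos|rewrite mulrA mp -mulrA mp mulrA].
have m2 : m * m = 0.
  have am0 : a * m = 0 by rewrite /a -mulrA xm mulr0.
  have pm0 : p * m = 0 by apply/eqP; rewrite -oppr_eq0 -am am0.
  by rewrite {1}/m mulrBl am0 pm0 subr0.
have m0 : m = 0.
  apply/cnorm0_eq0/eqP.
  by have := cnorm_starM m; rewrite mh m2 cnorm0 => /esym/eqP; rewrite expf_eq0.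
by rewrite (_ : a = p)//; apply/eqP; rewrite eq_sym -subr_eq0 -/m m0.
Qed.

Lemma mul_star_pos x : pos (x * star x).
Proof. by rewrite -{1}[x]starK; exact: star_mul_pos. Qed.

Lemma pos_conj a x : pos a -> pos (star x * a * x).
Proof.
move=> /pos_sqrt[k [kp <- _]].
rewrite (_ : _ * _ = star (k * x) * (k * x)); first exact: star_mul_pos.
by rewrite starM (pos_herm kp) !mulrA.
Qed.

(** If [a] is within [c] of the scalar [c], then [r + a = (c + r)(1 - x)] with
    [cnorm x <= c / (c + r) < 1]: a geometric series inverts it, and [k] is the root of the inverse
    [g]. *)
Lemma pos_add_scalar_inv_sqrt a r : pos a -> 0 < r ->
  exists2 k, star k = k & k * (r%:C%:A + a) * k = 1.
Proof.
move=> pa r0; have [ah [c c0 ac]] := pa.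
have d0 : 0 < c + r by rewrite ltr_wpDl.
set h := r%:C%:A + a; have hh : star h = h by rewrite starD star_scalar ah.
have dV : 0 <= (c + r)^-1 by rewrite invr_ge0 ltW.
pose x : A := (c + r)^-1%:C *: (c%:C%:A - a).
have dK (b : A) : (c + r)%:C *: ((c + r)^-1%:C *: b) = b.
  by rewrite scalerA -rmorphM mulfV ?gt_eqF// scale1r.
have x1 : cnorm x < 1.
  rewrite cnormZr// mulrC ltr_pdivrMr// mul1r (le_lt_trans ac)// ltrDl//.
have hx : h = (c + r)%:C *: (1 - x).
  by rewrite scalerBr dK rmorphD scalerDl [_ + r%:C%:A]addrC addrKA opprK.
have [y xy yx] := one_sub_invertible Ac x1.
pose g := (c + r)^-1%:C *: y.
have hg : h * g = 1.
  by rewrite hx /g -scalerAl -scalerAr scalerA -rmorphM mulfV ?gt_eqF// scale1r.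
have gh : g * h = 1.
  by rewrite hx /g -scalerAl -scalerAr scalerA -rmorphM mulVf ?gt_eqF// scale1r.
have gs : star g = g.
  by rewrite -[LHS]mulr1 -hg mulrA -{1}hh -starM hg star1 mul1r.
(* The inverse is positive because [g = star g * h * g]. *)
have pg : pos g.
  rewrite -[g]mul1r -gh -{1}gs; apply: pos_conj.
  by apply: posD => //; apply/pos_scalar/ltW.
have [k [kp kk kc]] := pos_sqrt pg.
exists k; first exact: pos_herm.
by rewrite -mulrA (kc h) ?hg ?gh// mulrA kk gh.
Qed.

End PositiveComplete.

(** * Ultrafilter limits of bounded sequences *)

Lemma fmap_ultra T U (f : T -> U) (F : set_system T) :
  UltraFilter F -> UltraFilter (f @ F).
Proof.
move=> FU; split; first exact: fmap_proper_filter.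
move=> G GF sFG; rewrite predeqE => A; split; last exact: sFG.
move=> GA; have [//|FA] := in_ultra_setVsetC (f @^-1` A) FU.
have /filter_ex[y []//] : G (A `&` ~` A) by apply: filterI => //; exact: sFG.
Qed.

Section UltraLimit.
Context {R : realType}.
Local Open Scope complex_scope.

(** Push an ultrafilter refining [\oo] forward along a bounded sequence: the image converges by
    compactness of a segment, and genuine limits are preserved because of the refinement. *)
Lemma exists_ultra_limit : exists L : (nat -> R) -> R,
  [/\ forall (c : R) u v, (exists M, forall n, `|u n| <= M) ->
        (exists M, forall n, `|v n| <= M) ->
        L (fun n => c * u n + v n) = c * L u + L v,
      forall u, (exists M, forall n, `|u n| <= M) -> (forall n, 0 <= u n) ->
        0 <= L u
    & forall u l, (forall e, 0 < e -> exists N, forall n, (N <= n)%N ->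
        `|u n - l| <= e) -> L u = l].
Proof.
have [G [GU sG]] := @ultraFilterLemma nat \oo _.
have Gcvg (u : nat -> R) : (exists M, forall n, `|u n| <= M) -> cvg (u @ G).
  move=> [M uM]; have cpt := @segment_compact R (- M) M.
  rewrite compact_ultra /mkset in cpt.
  move: cpt => /(_ (u @ G) (fmap_ultra u GU))[|l [_ ul]]; last first.
    by apply/cvg_ex; exists l.
  apply: (@filterE _ G) => n. rewrite /= in_itv /= -ler_norml. exact: uM.
exists (fun u => lim ((u : nat -> R) @ G)); split.
- move=> c u v /Gcvg uc /Gcvg vc; apply: cvg_lim => //.
  by apply: cvgD => //; apply: cvgM => //; exact: cvg_cst.
- move=> u /Gcvg uc u0; apply: limr_ge => //; exact: nearW.
- move=> u l ul; apply: cvg_lim => //.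
  apply: (cvg_trans (cvg_app u sG)).
  apply/cvgrPdist_le => e e0; have [N HN] := ul e e0.
  by exists N => // n /HN; rewrite distrC.
Qed.

Let L := sval (cid exists_ultra_limit).

Definition bdd_seq (u : nat -> R[i]) :=
  exists M : R, forall n, Normc.normc (u n) <= M.

Definition ulim (u : nat -> R[i]) : R[i] :=
  L (fun n => complex.Re (u n)) +i* L (fun n => complex.Im (u n)).

Lemma normc_Re (z : R[i]) : `|complex.Re z| <= Normc.normc z.
Proof. by case: z => x y /=; rewrite -sqrtr_sqr ler_wsqrtr// lerDl sqr_ge0. Qed.

Lemma normc_Im (z : R[i]) : `|complex.Im z| <= Normc.normc z.
Proof. by case: z => x y /=; rewrite -sqrtr_sqr ler_wsqrtr// lerDr sqr_ge0. Qed.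

Lemma normc_le_ReIm (z : R[i]) : Normc.normc z <= `|complex.Re z| + `|complex.Im z|.
Proof.
case: z => x y /=.
rewrite -[leRHS]ger0_norm ?addr_ge0// -sqrtr_sqr ler_wsqrtr//.
rewrite sqrrD !real_normK ?num_real//.
by rewrite -addrA [_ *+ 2 + _]addrC addrA lerDl mulrn_wge0// mulr_ge0.
Qed.

Lemma bdd_Re u : bdd_seq u -> exists M : R, forall n, `|complex.Re (u n)| <= M.
Proof. by move=> [M uM]; exists M => n; apply: le_trans (normc_Re _) (uM n). Qed.

Lemma bdd_Im u : bdd_seq u -> exists M : R, forall n, `|complex.Im (u n)| <= M.
Proof. by move=> [M uM]; exists M => n; apply: le_trans (normc_Im _) (uM n). Qed.

Lemma bdd_cst c : bdd_seq (fun=> c).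
Proof. by exists (Normc.normc c). Qed.

Lemma bddD u v : bdd_seq u -> bdd_seq v -> bdd_seq (fun n => u n + v n).
Proof.
move=> [M uM] [N vN]; exists (M + N) => n.
by rewrite (le_trans (le_normcD _ _))// lerD.
Qed.

Let LD c (u v : nat -> R) : (exists M, forall n, `|u n| <= M) ->
  (exists M, forall n, `|v n| <= M) -> L (fun n => c * u n + v n) = c * L u + L v.
Proof. by rewrite /L; case: cid => /= ? [h _ _]; exact: h. Qed.

Let L_ge0 u : (exists M, forall n, `|u n| <= M) -> (forall n, 0 <= u n) -> 0 <= L u.
Proof. by rewrite /L; case: cid => /= ? [_ h _]; exact: h. Qed.

Let L_cvg u l : (forall e, 0 < e -> exists N, forall n, (N <= n)%N ->
  `|u n - l| <= e) -> L u = l.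
Proof. by rewrite /L; case: cid => /= ? [_ _ h]; exact: h. Qed.

Let L_cst c : L (fun=> c) = c.
Proof. by apply: L_cvg => e e0; exists 0%N => n _; rewrite subrr normr0 ltW. Qed.

Let L_norm u M : (forall n, `|u n| <= M) -> `|L u| <= M.
Proof.
move=> uM; have bu : exists M, forall n, `|u n| <= M by exists M.
have bM : exists M', forall n : nat, `|M| <= M' by exists `|M|.
have h c : `|c| = 1 -> c * L u <= M.
  move=> c1; have := @LD (-1) (fun n => c * u n + 0) (fun=> M).
  rewrite (@LD c u (fun=> 0)) ?L_cst//; last by exists 0 => ?; rewrite normr0.
  move=> e; rewrite -subr_ge0.
  rewrite (_ : M - _ = -1 * (c * L u + 0) + M); last by ring.
  have bcu : exists M, forall n, `|c * u n + 0| <= M.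
    by exists M => n; rewrite addr0 normrM c1 mul1r.
  rewrite -e//; apply: L_ge0.
    exists (M + `|M|) => n; rewrite mulN1r (le_trans (ler_normD _ _))// lerD//.
    by rewrite normrN addr0 normrM c1 mul1r.
  move=> n; rewrite addr0 mulN1r addrC subr_ge0 (le_trans (ler_norm _))//.
  by rewrite normrM c1 mul1r.
rewrite ler_norml; apply/andP; split.
  have := h (-1); rewrite normrN1 => /(_ erefl); lra.
by have := h 1; rewrite normr1 mul1r => /(_ erefl).
Qed.

Lemma ulimD c u v : bdd_seq u -> bdd_seq v ->
  ulim (fun n => c * u n + v n) = c * ulim u + ulim v.
Proof.
move=> bu bv; rewrite /ulim; case: c => a b.
have re n : complex.Re ((a +i* b) * u n + v n) =
    a * complex.Re (u n) + ((- b) * complex.Im (u n) + complex.Re (v n)).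
  by case: (u n) (v n) => ? ? [? ?] /=; ring.
have im n : complex.Im ((a +i* b) * u n + v n) =
    a * complex.Im (u n) + (b * complex.Re (u n) + complex.Im (v n)).
  by case: (u n) (v n) => ? ? [? ?] /=; ring.
have bdd1 c (f g : nat -> R) : (exists M, forall n, `|f n| <= M) ->
    (exists M, forall n, `|g n| <= M) -> exists M, forall n, `|c * f n + g n| <= M.
  move=> [M fM] [N gN]; exists (`|c| * M + N) => n.
  by rewrite (le_trans (ler_normD _ _))// normrM lerD// ler_wpM2l.
under [X in L X]funext do rewrite re.
under [X in _ +i* L X]funext do rewrite im.
rewrite !LD; try exact: bdd_Re; try exact: bdd_Im;
  try (apply: bdd1; first [exact: bdd_Re|exact: bdd_Im]).
by apply/eqP; rewrite eq_complex /=; apply/andP; split; apply/eqP; ring.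
Qed.

Lemma ulim_cvg u l : (forall e : R, 0 < e -> exists N, forall n, (N <= n)%N ->
  Normc.normc (u n - l) <= e) -> ulim u = l.
Proof.
move=> ul; apply/eqP; rewrite eq_complex /=; apply/andP; split; apply/eqP.
  apply: L_cvg => e /ul[N HN]; exists N => n /HN; apply: le_trans.
  by have := normc_Re (u n - l); case: (u n) l {HN ul} => ? ? [].
apply: L_cvg => e /ul[N HN]; exists N => n /HN; apply: le_trans.
by have := normc_Im (u n - l); case: (u n) l {HN ul} => ? ? [].
Qed.

Lemma ulim_cst c : ulim (fun=> c) = c.
Proof.
by apply: ulim_cvg => e e0; exists 0%N => n _; rewrite subrr Normc.normc0 ltW.
Qed.

(** Real and imaginary limits are bounded separately, hence the doubled constant. *)
Lemma ulim_norm u (M : R) : (forall n, Normc.normc (u n) <= M) ->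
  Normc.normc (ulim u) <= M + M.
Proof.
move=> uM; rewrite (le_trans (normc_le_ReIm _))// lerD//; apply: L_norm => n.
  exact: le_trans (normc_Re _) (uM n).
exact: le_trans (normc_Im _) (uM n).
Qed.

Lemma ulim_ge0 u : bdd_seq u -> (forall n, 0 <= u n) -> 0 <= ulim u.
Proof.
move=> bu u0; rewrite lecE /=; apply/andP; split.
  rewrite (_ : (fun n => complex.Im (u n)) = fun=> 0) ?L_cst//.
  by apply/funext => n; rewrite ger0_Im.
apply: L_ge0; first exact: bdd_Re.
by move=> n; have := u0 n; rewrite lecE => /andP[].
Qed.

Lemma ulim_add u v : bdd_seq u -> bdd_seq v ->
  ulim (fun n => u n + v n) = ulim u + ulim v.
Proof.
move=> bu bv; rewrite -[ulim u]mul1r -ulimD//; congr ulim; apply/funext => n.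
by rewrite mul1r.
Qed.

End UltraLimit.

(** * Jordan decomposition of bounded traces *)

Lemma scale_regE (K : nzRingType) (c : K) (z : K^o) : c *: z = c * z.
Proof. by []. Qed.

Section HermitianParts.
Context {R : realType} {A : preCStarAlgType R}.
Hypothesis Ac : cauchy_complete A.
Implicit Types (a b u w : A) (r : R).
Local Open Scope complex_scope.

Definition herm_part a : A := 2^-1%:C *: (a + star a).
Definition antiherm_part a : A := herm_part (- 'i *: a).

Lemma herm_part_herm a : star (herm_part a) = herm_part a.
Proof. by rewrite /herm_part starZr starD starK addrC. Qed.

Lemma herm_part_cnorm a : cnorm (herm_part a) <= cnorm a.
Proof.
rewrite cnormZr ?invr_ge0// -[leRHS](_ : 2^-1 * (cnorm a + cnorm a) = _); last by field.
by rewrite ler_wpM2l ?invr_ge0// (le_trans (cnormD_le _ _))// cnorm_star.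
Qed.

Lemma antiherm_part_cnorm a : cnorm (antiherm_part a) <= cnorm a.
Proof.
by rewrite (le_trans (herm_part_cnorm _))// cnormZ normcN normci mul1r.
Qed.

Lemma herm_decomp a : a = herm_part a + 'i *: antiherm_part a.
Proof.
have e : 'i *: (- ('i *: a) + 'i *: star a) = a - star a.
  by rewrite scalerDr scalerN !scalerA complex_iM !scaleN1r opprK.
rewrite /antiherm_part /herm_part scaleNr starN starZi opprK.
rewrite [X in _ + X]scalerA mulrC -scalerA e -scalerDr addrACA subrr addr0.
by rewrite half_double.
Qed.

Lemma linear_herm_decomp (f : {linear A -> R[i]^o}) a :
  f a = f (herm_part a) + 'i * f (antiherm_part a).
Proof. by rewrite {1}[a]herm_decomp linearD; congr (_ + _); exact: linearZ. Qed.

(** The unitary is [b + i sqrt (1 - b^2)]. A hermitian contraction is thus a mean of two unitaries,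
    which lets invariance under unitaries imply the trace property. *)
Lemma cnorm_le1_unitary b : star b = b -> cnorm b <= 1 ->
  exists u, [/\ star u * u = 1, u * star u = 1 & u + star u = b + b].
Proof.
move=> bh b1.
have bb1 : cnorm (b * b) <= 1.
  by rewrite (le_trans (cnormM_le _ _))// mulr_ile1 ?cnorm_ge0.
have bbh : star (b * b) = b * b by rewrite starM bh.
have [y [yh _ yy yc]] := one_sub_sqrt Ac bbh bb1.
have bw : b * (1 - y) = (1 - y) * b.
  by rewrite mulrBr mulrBl mulr1 mul1r yc// mulrA.
have wh : star (1 - y) = 1 - y by rewrite starB star1 yh.
set w := 1 - y in bw wh yy.
have bbww : b * b + w * w = 1 by rewrite yy addrC subrK.
have su : star (b + 'i *: w) = b - 'i *: w by rewrite starD starZi bh wh.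
exists (b + 'i *: w); rewrite su; split.
- rewrite mulrDr !mulrBl -!scalerAl -!scalerAr bw scalerA complex_iM scaleN1r opprK.
  by rewrite -bbww addrA subrK.
- rewrite mulrBr !mulrDl -!scalerAl -!scalerAr bw scalerA complex_iM scaleN1r.
  by rewrite opprD opprK addrA addrK.
- by rewrite addrACA subrr addr0.
Qed.

(** The order interval between 0 and 1. It takes the place of the projections in a Hahn
    decomposition, of which a C*-algebra may have too few. *)
Definition effect w := pos w /\ pos (1 - w).

Lemma effect0 : effect 0.
Proof. by split; [exact: pos0|rewrite subr0; exact: pos1]. Qed.

Lemma effect1 : effect 1.
Proof. by split; [exact: pos1|rewrite subrr; exact: pos0]. Qed.

Lemma effect_cnorm w : effect w -> cnorm w <= 1.
Proof. by move=> [p q]; apply: pos_cnorm_le => //; rewrite scale1r. Qed.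

Lemma effect_unitary u w : u * star u = 1 -> effect w -> effect (u * w * star u).
Proof.
have conj a : pos a -> pos (u * a * star u).
  by move=> pa; rewrite -{1}[u]starK; exact: pos_conj.
move=> uu [p q]; split; first exact: conj.
have -> : 1 - u * w * star u = u * (1 - w) * star u by rewrite mulrBr mulr1 mulrBl uu.
exact: conj.
Qed.

Lemma pos_scaled_effect a : pos a ->
  exists2 r, 0 < r & effect (r^-1%:C *: a).
Proof.
move=> pa; have r0 : 0 < cnorm a + 1 by rewrite ltr_wpDl ?cnorm_ge0.
exists (cnorm a + 1) => //; have rV : 0 <= (cnorm a + 1)^-1 by rewrite invr_ge0 ltW.
split; first exact: posZ.
have e1 : 1 = (1 : R)%:C%:A :> A by rewrite scale1r.
rewrite e1; apply: pos_scalarB.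
  by rewrite starZr pos_herm.
by rewrite cnormZr// mulrC ler_pdivrMr// mul1r lerDl.
Qed.

Lemma linear_eq0_on_effects (f : {linear A -> R[i]^o}) :
  (forall w, effect w -> f w = 0) -> forall a, f a = 0.
Proof.
move=> f0.
have fpos a : pos a -> f a = 0.
  move=> /pos_scaled_effect[r r0 /f0]; rewrite linearZ/= => /eqP.
  rewrite scaler_eq0 => /predU1P[/eqP|/eqP//].
  by rewrite eq_complex /= eqxx andbT invr_eq0 gt_eqF.
have fherm a : star a = a -> f a = 0.
  move=> ah; have := fpos _ (pos_scalarD ah (lexx _)).
  by rewrite linearD/= (fpos _ (pos_scalar (cnorm_ge0 a))) add0r.
by move=> a; rewrite linear_herm_decomp !fherm ?mulr0 ?addr0//; exact: herm_part_herm.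
Qed.

End HermitianParts.

Section Traces.
Context {R : realType} {B : preCStarAlgType R}.
Hypothesis Bc : cauchy_complete B.
Implicit Types (a b u w : B) (r : R) (t p : trace_space B).
Local Open Scope complex_scope.

Definition mk_trace (f : B -> R[i]^o) (hf : bounded_trace f) : trace_space B :=
  exist (fun f => f \in _) f (mem_set hf).

Lemma trace_ext t p : (forall a, t a = p a) -> t = p.
Proof. by move=> tp; apply/val_inj/funext. Qed.

Lemma trace_comm t a b : t (a * b) = t (b * a).
Proof. by case: (trace_spaceP t). Qed.

Lemma trace_addE t p a : (t + p : trace_space B) a = t a + p a. Proof. by []. Qed.
Lemma trace_oppE t a : (- t : trace_space B) a = - t a. Proof. by []. Qed.
Lemma trace_scaleE c t a : (c *: t : trace_space B) a = c * t a. Proof. by []. Qed.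

Lemma trace_has_ub t :
  has_ubound [set Normc.normc (t b) | b in [set b : B | cnorm b <= 1]].
Proof.
have [_ [M tM] _] := trace_spaceP t.
exists `|M| => _ [b /= b1 <-].
rewrite (le_trans (tM b))// (le_trans (y := `|M| * cnorm b))//.
  by rewrite ler_wpM2r ?cnorm_ge0 ?ler_norm.
by rewrite ler_piMr.
Qed.

Lemma trace_normP t a : Normc.normc (t a) <= trace_norm t * cnorm a.
Proof.
have [->|a0] := eqVneq a 0; first by rewrite raddf0 cnorm0 mulr0 Normc.normc0.
have na : 0 < cnorm a.
  by rewrite lt_neqAle cnorm_ge0 andbT eq_sym; apply: contra_neq a0 => /cnorm0_eq0.
rewrite -ler_pdivrMr// mulrC.
have -> : (cnorm a)^-1 * Normc.normc (t a) = Normc.normc (t ((cnorm a)^-1%:C *: a)).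
  rewrite linearZ/= scale_regE Normc.normcM normcr ger0_norm//.
  by rewrite invr_ge0 ltW.
apply: ub_le_sup; first exact: trace_has_ub.
exists ((cnorm a)^-1%:C *: a) => //=.
by rewrite cnormZr ?invr_ge0 ?(ltW na)// mulVf ?gt_eqF.
Qed.

Lemma trace_norm_ge0 t : 0 <= trace_norm t.
Proof.
apply: le_trans (normc_ge0 (t 0)) _; apply: ub_le_sup; first exact: trace_has_ub.
by exists 0 => //=; rewrite cnorm0.
Qed.

Lemma trace_norm_le_of t (M : R) : 0 <= M ->
  (forall a, Normc.normc (t a) <= M * cnorm a) -> trace_norm t <= M.
Proof.
move=> M0 tM; apply: ge_sup; first by exists (Normc.normc (t 0)), 0 => //=; rewrite cnorm0.
by move=> _ [b /= b1 <-]; rewrite (le_trans (tM b))// ler_piMr.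
Qed.

Definition pos_trace t := forall a, pos a -> 0 <= t a.

(** On positive traces it agrees with the norm up to a factor 2 ([mass_le], [pos_trace_bound]), and
    it is real-linear, so identities between traces become identities between masses. *)
Definition mass t : R := complex.Re (t 1).

Lemma pos_traceP t : pos_trace t <-> forall a, 0 <= t (star a * a).
Proof.
split=> [tp a|tp a /(pos_sqrt Bc)[k [kp <- _]]]; first exact/tp/star_mul_pos.
by rewrite -{1}(pos_herm kp).
Qed.

Lemma pos_trace_mass t : pos_trace t -> t 1 = (mass t)%:C.
Proof.
move=> /(_ _ (@pos1 _ _))/ger0_Im; rewrite /mass.
by case: (t 1) => x y /= ->.
Qed.

Lemma mass_ge0 t : pos_trace t -> 0 <= mass t.
Proof. by move=> tp; rewrite -lecR -pos_trace_mass// tp// ; exact: pos1. Qed.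

Lemma massD t p : mass (t + p) = mass t + mass p.
Proof. by rewrite /mass trace_addE; case: (t 1) (p 1) => ? ? []. Qed.

Lemma massZ r t : mass (r%:C *: t) = r * mass t.
Proof. by rewrite /mass trace_scaleE; case: (t 1) => ? ? /=; rewrite mul0r subr0. Qed.

Lemma mass_le t : mass t <= trace_norm t.
Proof.
rewrite (le_trans (ler_norm _))// (le_trans (normc_Re _))// (le_trans (trace_normP _ _))//.
by rewrite ler_piMr ?trace_norm_ge0// cnorm1_le.
Qed.

Lemma pos_traceZ r t : 0 <= r -> pos_trace t -> pos_trace (r%:C *: t).
Proof. by move=> r0 tp a pa; rewrite trace_scaleE mulr_ge0 ?tp// ler0c. Qed.

Lemma pos_trace_herm_bound t a : pos_trace t -> star a = a ->
  Normc.normc (t a) <= mass t * cnorm a.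
Proof.
move=> tp ah.
have := tp _ (pos_scalarB ah (lexx _)); have := tp _ (pos_scalarD ah (lexx _)).
rewrite linearD linearB /= linearZ/= pos_trace_mass// scale_regE -rmorphM/=.
case: (t a) => x y; rewrite !lecE /= => /andP[/eqP e h1] /andP[_ h2].
have y0 : y = 0 by move: e; rewrite add0r.
rewrite y0 expr0n addr0 sqrtr_sqr ler_norml; apply/andP; split; lra.
Qed.

Lemma pos_trace_bound t a : pos_trace t ->
  Normc.normc (t a) <= 2 * mass t * cnorm a.
Proof.
move=> tp; have m0 := mass_ge0 tp.
rewrite (linear_herm_decomp t) (le_trans (le_normcD _ _))//.
rewrite Normc.normcM normci mul1r.
rewrite (_ : _ * _ * _ = mass t * cnorm a + mass t * cnorm a); last by ring.
rewrite lerD//; (rewrite (le_trans (pos_trace_herm_bound tp (herm_part_herm _)))//;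
  rewrite ler_wpM2l//).
  exact: herm_part_cnorm.
exact: antiherm_part_cnorm.
Qed.

Definition real_trace t := forall a, star a = a -> complex.Im (t a) = 0.

Section Jordan.
Variable t : trace_space B.
Hypothesis tr : real_trace t.

Let rt a : R := complex.Re (t a).

Let S := [set rt w | w in effect].
Let P := sup S.

Let rtD a b : rt (a + b) = rt a + rt b.
Proof. by rewrite /rt linearD/=; case: (t a) (t b) => ? ? []. Qed.

Let rtB a b : rt (a - b) = rt a - rt b.
Proof. by rewrite /rt linearB/=; case: (t a) (t b) => ? ? []. Qed.

Let S_sup : has_sup S.
Proof.
split; first by exists (rt 0), 0 => //; exact: effect0.
exists (trace_norm t) => _ [w ew <-].
rewrite (le_trans (ler_norm _))// (le_trans (normc_Re _))// (le_trans (trace_normP _ _))//.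
by rewrite ler_piMr ?trace_norm_ge0// (effect_cnorm Bc).
Qed.

Let rt_sandwich k w : rt (w * (k * k)) = rt (k * w * k).
Proof. by rewrite /rt mulrA trace_comm !mulrA. Qed.

Let split_le w w' a : effect w -> effect w' -> effect a ->
  rt (w * a) + rt (w' * (1 - a)) <= P.
Proof.
move=> [wp wq] [wp' wq'] [/(pos_sqrt Bc)[k [/pos_herm kh ka _]]].
move=> /(pos_sqrt Bc)[l [/pos_herm lh la _]].
rewrite -la -ka !rt_sandwich -rtD; apply: ub_le_sup; first by case: S_sup.
exists (k * w * k + l * w' * l) => //; split.
  by apply: posD; [rewrite -{1}kh|rewrite -{1}lh]; exact: pos_conj.
rewrite (_ : 1 - _ = k * (1 - w) * k + l * (1 - w') * l).
  by apply: posD; [rewrite -{1}kh|rewrite -{1}lh]; exact: pos_conj.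
rewrite !mulrBr !mulrBl !mulr1 ka la addrACA -opprD [a + _]addrC subrK//.
Qed.

Let max_seq_ex n : exists w, effect w /\ P - n.+1%:R^-1 < rt w.
Proof.
have [|_ [w ew <-] h] := sup_adherent _ S_sup (eps := n.+1%:R^-1).
  by rewrite invr_gt0.
by exists w.
Qed.

Let w n := sval (cid (max_seq_ex n)).
Let we n : effect (w n). Proof. by rewrite /w; case: cid => ? []. Qed.
Let wP n : P - n.+1%:R^-1 < rt (w n). Proof. by rewrite /w; case: cid => ? []. Qed.

Let bdd_w a : bdd_seq (fun n => t (w n * a)).
Proof.
exists (trace_norm t * cnorm a) => n; rewrite (le_trans (trace_normP _ _))//.
rewrite ler_wpM2l ?trace_norm_ge0// (le_trans (cnormM_le _ _))//.
by rewrite ler_piMl ?cnorm_ge0// (effect_cnorm Bc).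
Qed.

Let f a : R[i]^o := ulim (fun n => t (w n * a)).

Let f_linear : linear f.
Proof.
move=> c a b; rewrite /f scale_regE -ulimD; [|exact: bdd_w|exact: bdd_w].
by congr ulim; apply/funext => n; rewrite mulrDr -scalerAr linearP.
Qed.

Let inv_lt (e : R) : 0 < e -> exists N, forall n, (N <= n)%N -> n.+1%:R^-1 <= e.
Proof.
move=> e0; exists (Num.trunc e^-1) => n Nn.
rewrite invf_ple ?posrE//; apply: ltW.
have := @truncnS_gt _ e^-1; rewrite -/(Num.trunc e^-1) => h.
by apply: lt_le_trans h _; rewrite ler_nat.
Qed.

Let cinv_norm n : Normc.normc (n.+1%:R^-1%:C : R[i]) = n.+1%:R^-1.
Proof. by rewrite normcr ger0_norm ?invr_ge0. Qed.

Let ulim_inv : ulim (fun n => n.+1%:R^-1%:C : R[i]) = 0.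
Proof.
apply: ulim_cvg => e /inv_lt[N HN]; exists N => n /HN.
by rewrite subr0 cinv_norm.
Qed.

Let bdd_inv : bdd_seq (fun n => n.+1%:R^-1%:C : R[i]).
Proof.
by exists 1 => n; rewrite cinv_norm invf_le1// ler1n.
Qed.

Let im_eff v a : effect v -> effect a -> complex.Im (t (v * a)) = 0.
Proof.
move=> [vp _] [/(pos_sqrt Bc)[k [/pos_herm kh <- _]] _].
rewrite mulrA trace_comm mulrA; apply: tr.
by rewrite !starM kh (pos_herm vp) mulrA.
Qed.

Let cge0 (z : R[i]) : complex.Im z = 0 -> 0 <= complex.Re z -> 0 <= z.
Proof. by move=> z0 z1; rewrite lecE z0 z1 eqxx. Qed.

Let lim_ge0 (s : nat -> R[i]) : bdd_seq s ->
  (forall n, 0 <= s n + n.+1%:R^-1%:C) -> 0 <= ulim s.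
Proof.
move=> bs s0; rewrite -[ulim s]addr0 -[X in _ + X]ulim_inv -ulim_add//.
by apply: ulim_ge0 => //; exact: bddD.
Qed.

(** The effect built from [0] on [a] and [w n] on [1 - a] cannot beat the supremum [P], which [w n]
    nearly attains; so [t (w n * a)] is at least [- 1 / (n + 1)]. *)
Let f_effect_ge0 a : effect a -> 0 <= f a.
Proof.
move=> ea; apply: lim_ge0; first exact: bdd_w.
move=> n; apply: cge0.
  by have := im_eff (we n) ea; case: (t _) => x y /= ->; rewrite addr0.
have := split_le effect0 (we n) ea; have := wP n.
rewrite mul0r mulrBr mulr1 rtB /rt linear0 /=.
case: (t (w n * a)) => x y /=; move: P n.+1%:R^-1 (complex.Re _) => Q d z; lra.
Qed.

(** The same comparison, with [1] instead of [0] on [a]. *)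
Let f_sub_effect_ge0 a : effect a -> 0 <= f a - t a.
Proof.
move=> ea; have -> : f a - t a = ulim (fun n => t (w n * a) + - t a).
  by rewrite ulim_add ?ulim_cst//; exact: bdd_cst.
apply: lim_ge0; first by apply: bddD; [exact: bdd_w|exact: bdd_cst].
have := tr (pos_herm ea.1) => ta0.
move=> n; apply: cge0.
  have := im_eff (we n) ea; case: (t (_ * _)) => x y /= ->.
  by move: ta0; case: (t a) => x' y' /= ->; rewrite oppr0 !addr0.
have := split_le effect1 (we n) ea; have := wP n.
rewrite mul1r mulrBr mulr1 rtB /rt.
case: (t (w n * a)) (t a) => x y [x' y'] /=.
move: P n.+1%:R^-1 (complex.Re _) => Q d z; lra.
Qed.

Let f_unitary u : star u * u = 1 -> u * star u = 1 ->
  forall a, f (star u * a * u) = f a.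
Proof.
move=> uu uu'.
have hl : linear (fun a => f (star u * a * u) - f a : R[i]^o).
  move=> c a b; rewrite mulrDr mulrDl -scalerAr -scalerAl !f_linear.
  by rewrite scalerBr opprD addrACA.
pose g := HB.pack_for {linear B -> R[i]^o} (fun a => f (star u * a * u) - f a : R[i]^o)
  (GRing.isLinear.Build _ _ _ _ _ hl).
move=> a; apply/eqP; rewrite -subr_eq0; apply/eqP.
suff : g a = 0 by [].
apply: linear_eq0_on_effects => {}a ea.
rewrite /= /f -[X in _ - X]mul1r -mulNr addrC -ulimD; [|exact: bdd_w|exact: bdd_w].
apply: ulim_cvg => e /inv_lt[N HN]; exists N => n /HN; apply: le_trans.
rewrite subr0 mulN1r.
have -> : t (w n * (star u * a * u)) = t (u * w n * star u * a).
  by rewrite !mulrA trace_comm !mulrA.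
have ew := effect_unitary Bc uu' (we n).
(* The conjugate of [w n] has the same value under [t], so it is as close to maximal. The two orders
   of the pair bound the difference from both sides by [1 / (n + 1)]. *)
have h1 := split_le (we n) ew ea; have h2 := split_le ew (we n) ea.
have e' : rt (u * w n * star u) = rt (w n).
  by rewrite /rt trace_comm mulrA uu mul1r.
have h3 := wP n; rewrite !mulrBr !mulr1 !rtB e' in h1 h2.
have := im_eff (we n) ea; have := im_eff ew ea.
move: h1 h2 h3; rewrite /rt.
move: (t (w n * a)) (t (u * w n * star u * a)) => [x y] [x' y'] /=.
move: P n.+1%:R^-1 (complex.Re _) => Q d z h1 h2 h3 -> ->.
rewrite oppr0 addr0 expr0n addr0 sqrtr_sqr ler_norml.
by apply/andP; split; lra.
Qed.

(** By linearity [a] may be an effect, hence half of [u + star u] for a unitary [u]. For a unitary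
    [v], conjugating [v * b] gives [b * v], so [f_unitary] settles that case. *)
Let f_comm a b : f (a * b) = f (b * a).
Proof.
have hl : linear (fun a => f (a * b) - f (b * a) : R[i]^o).
  move=> c x y; rewrite mulrDr mulrDl -scalerAr -scalerAl !f_linear.
  by rewrite scalerBr opprD addrACA.
pose g := HB.pack_for {linear B -> R[i]^o} (fun a => f (a * b) - f (b * a) : R[i]^o)
  (GRing.isLinear.Build _ _ _ _ _ hl).
apply/eqP; rewrite -subr_eq0; apply/eqP; suff : g a = 0 by [].
apply: linear_eq0_on_effects => {}a ea.
have [u [uu uu' ua]] := cnorm_le1_unitary Bc (pos_herm ea.1) (effect_cnorm Bc ea).
have gu v : star v * v = 1 -> v * star v = 1 -> g v = 0.
  move=> vv vv'; apply/eqP; rewrite /= subr_eq0; apply/eqP.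
  by rewrite -(f_unitary vv vv' (v * b)) mulrA vv mul1r.
have : g (u + star u) = 0.
  by rewrite linearD (gu u)// (gu (star u)) ?starK// addr0.
rewrite ua -mulr2n -scaler_nat linearZ => /eqP.
by rewrite scaler_eq0 pnatr_eq0 => /eqP.
Qed.

Let f_bound a : Normc.normc (f a) <= (trace_norm t + trace_norm t) * cnorm a.
Proof.
rewrite mulrDl; apply: ulim_norm => n.
rewrite (le_trans (trace_normP _ _))// ler_wpM2l ?trace_norm_ge0//.
rewrite (le_trans (cnormM_le _ _))//.
by rewrite ler_piMl ?cnorm_ge0// (effect_cnorm Bc).
Qed.

Let f_trace : bounded_trace f.
Proof. by split=> //; exists (trace_norm t + trace_norm t). Qed.

Let pos_of_effect (g : trace_space B) :
  (forall a, effect a -> 0 <= g a) -> pos_trace g.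
Proof.
move=> g0 a /pos_scaled_effect[r r0 /g0].
by rewrite linearZ/= scale_regE pmulr_rge0// ltcR invr_gt0.
Qed.

(* The positive part of [t] is the limit of [a |-> t (w_n a)], where the effects
   [w_n] maximise [t].  For effects [w], [w'] and [a], the element
   [a^(1/2) w a^(1/2) + (1-a)^(1/2) w' (1-a)^(1/2)] is again an effect, so
   [t (w a) + t (w' (1 - a))] is at most the supremum; hence any two almost
   maximising effects give almost the same functional, in particular [w_n] and
   its unitary conjugates, which makes the limit a trace. *)
Lemma jordan_real : exists p : trace_space B,
  [/\ pos_trace p, pos_trace (p - t) & mass p <= 2 * trace_norm t].
Proof.
exists (mk_trace f_trace); split.
- exact: pos_of_effect.
- exact: pos_of_effect.
- apply: le_trans (mass_le _) _; apply: trace_norm_le_of.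
    by rewrite mulr_ge0 ?trace_norm_ge0.
  by move=> a; rewrite mulr2n mulrDl mul1r; exact: f_bound.
Qed.

End Jordan.

Let hfun t a : R[i]^o := 2^-1%:C * (t a + (t (star a))^*%C).

Let conjcD (x y : R[i]) : (x + y)^*%C = x^*%C + y^*%C.
Proof. by case: x y => ? ? [? ?] /=; rewrite opprD. Qed.
Let conjcM (x y : R[i]) : (x * y)^*%C = x^*%C * y^*%C.
Proof. exact: rmorphM. Qed.

Let normcJ' (z : R[i]) : Normc.normc z^*%C = Normc.normc z.
Proof. by case: z => x y /=; rewrite sqrrN. Qed.

Let hfun_bound t a : Normc.normc (hfun t a) <= trace_norm t * cnorm a.
Proof.
rewrite /hfun Normc.normcM normcr ger0_norm ?invr_ge0// mulrC ler_pdivrMr//.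
rewrite mulr2n mulrDr mulr1 (le_trans (le_normcD _ _))// lerD ?trace_normP//.
by rewrite normcJ' (le_trans (trace_normP _ _))// cnorm_star.
Qed.

Let hfun_trace t : bounded_trace (hfun t).
Proof.
split.
- move=> c a b; rewrite /hfun !(linearP t) starD starZ linearD linearZ /=.
  rewrite conjcD !scale_regE conjcM.
  rewrite [X in _ + (X * _ + _)](_ : _ = c); last exact: conjcK.
  by ring.
- by exists (trace_norm t) => a; exact: hfun_bound.
- by move=> a b; rewrite /hfun !starM trace_comm [t (star b * _)]trace_comm.
Qed.

Let herm_trace t := mk_trace (hfun_trace t).

Let herm_trace_real t : real_trace (herm_trace t).
Proof.
move=> a ah; rewrite [herm_trace _ _]/(hfun _ _) /hfun ah.
by case: (t a) => x y /=; rewrite subrr !mul0r mulr0 addr0.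
Qed.

(** Apply [jordan_real] to the hermitian parts of [t] and of [- 'i *: t]. The 3 is 2 for the
    positive part from [jordan_real], plus 1 for the hermitian trace subtracted from it. *)
Lemma trace_decomposition t : exists p1 p2 p3 p4 : trace_space B,
  [/\ t = (p1 - p2) + 'i *: (p3 - p4),
      [/\ pos_trace p1, pos_trace p2, pos_trace p3 & pos_trace p4]
    & [/\ mass p1 <= 3 * trace_norm t, mass p2 <= 3 * trace_norm t,
        mass p3 <= 3 * trace_norm t & mass p4 <= 3 * trace_norm t]].
Proof.
have t0 := trace_norm_ge0 t.
have jd s : trace_norm s <= trace_norm t -> exists p q : trace_space B,
    [/\ herm_trace s = p - q, pos_trace p, pos_trace q,
        mass p <= 3 * trace_norm t & mass q <= 3 * trace_norm t].
  move=> st; have hs : trace_norm (herm_trace s) <= trace_norm t.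
    apply: trace_norm_le_of => // a; apply: le_trans (hfun_bound _ _) _.
    by rewrite ler_wpM2r ?cnorm_ge0.
  have [p [pp pq pm]] := jordan_real (@herm_trace_real s).
  exists p, (p - herm_trace s); split => //.
  - by rewrite opprB addrC subrK.
  - by lra.
  - rewrite /mass trace_addE trace_oppE -/(mass _).
    have : `|complex.Re (herm_trace s 1)| <= trace_norm t.
      rewrite (le_trans (normc_Re _))// (le_trans (trace_normP _ _))//.
      by rewrite (le_trans _ hs)// ler_piMr ?trace_norm_ge0// cnorm1_le.
    rewrite ler_norml => /andP[h _]; move: pm h; rewrite /mass.
    by case: (p 1) (herm_trace s 1) => x y [x' y'] /=; lra.
have [p1 [p2 [e1 P1 P2 m1 m2]]] := jd t (lexx _).
have [|p3 [p4 [e2 P3 P4 m3 m4]]] := jd (- 'i *: t).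
  apply: trace_norm_le_of => // a; rewrite trace_scaleE Normc.normcM normcN normci.
  by rewrite mul1r trace_normP.
exists p1, p2, p3, p4; split => //; rewrite -e1 -e2; apply: trace_ext => a.
rewrite trace_addE trace_scaleE.
rewrite [herm_trace t _]/(hfun _ _) [herm_trace _ _]/(hfun _ _) /hfun !trace_scaleE.
case: (t a) (t (star a)) => x y [x' y'].
by apply/eqP; rewrite eq_complex /=; apply/andP; split; apply/eqP; field.
Qed.

End Traces.

(** * Growth of positive shifts on traces *)

Section PerronFrobenius.
Context {R : realType} {B : preCStarAlgType R}.
Hypothesis Bc : cauchy_complete B.
Local Open Scope complex_scope.
Notation T := (trace_space B).
Implicit Types (t p : T) (a : B) (r : R) (q : R[i]).

Variables (S : T -> T) (phi : B -> B).
Hypothesis SE : forall t a, S t a = t (phi a).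
Hypothesis S_pos : forall t, pos_trace t -> pos_trace (S t).

Lemma shift_linear : linear S.
Proof. by move=> c t p; apply: trace_ext => a; rewrite SE !trace_addE !trace_scaleE !SE. Qed.

Lemma iter_shift_pos n t : pos_trace t -> pos_trace (iter n S t).
Proof. by move=> tp; elim: n => //= n; exact: S_pos. Qed.

Lemma iter_shiftE n t a : iter n S t a = t (iter n phi a).
Proof. by elim: n a => // n IH a; rewrite iterS SE IH iterSr. Qed.

(** The 2 comes from [pos_trace_bound]; the added 1 makes the constant positive even if
    [phi 1 = 0]. *)
Let C := 2 * cnorm (phi 1) + 1.

Lemma shift_mass t : pos_trace t -> mass (S t) <= C * mass t.
Proof.
move=> tp; have m0 := mass_ge0 tp.
rewrite /mass SE (le_trans (ler_norm _))// (le_trans (normc_Re _))//.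
rewrite (le_trans (pos_trace_bound _ tp))// -/(mass t) /C.
by move: (cnorm _) (mass t) m0 => c m m0; lra.
Qed.

Lemma shift_const_gt0 : 0 < C.
Proof. by rewrite /C ltr_wpDl// mulr_ge0// cnorm_ge0. Qed.

Lemma iter_shift_mass n t : pos_trace t -> mass (iter n S t) <= C ^+ n * mass t.
Proof.
move=> tp; elim: n => [|n IH]; first by rewrite expr0 mul1r.
rewrite iterS (le_trans (shift_mass (iter_shift_pos _ tp)))//.
by rewrite exprS -mulrA ler_wpM2l// ltW// shift_const_gt0.
Qed.

Definition growth : set R := [set rho | 0 <= rho /\
  exists2 K, 0 <= K &
    forall n t, pos_trace t -> mass (iter n S t) <= K * rho ^+ n * mass t].

Definition growth_rate := inf growth.

Lemma has_inf_growth : has_inf growth.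
Proof.
split; last by exists 0 => r [].
exists C; split; first exact/ltW/shift_const_gt0.
by exists 1 => // n t tp; rewrite mul1r iter_shift_mass.
Qed.

Lemma growth_rate_ge0 : 0 <= growth_rate.
Proof. by apply: lb_le_inf; [case: has_inf_growth|move=> r []]. Qed.

Lemma growth_rate_le r : growth r -> growth_rate <= r.
Proof. by move=> gr; apply: ge_inf => //; case: has_inf_growth. Qed.

Lemma growth_rate_lt r : growth_rate < r -> exists2 rho, growth rho & rho < r.
Proof.
move=> h; have e0 : 0 < r - growth_rate by rewrite subr_gt0.
have [rho grho hrho] := inf_adherent e0 has_inf_growth.
by exists rho => //; rewrite (lt_le_trans hrho)// addrC subrK.
Qed.

(** The factor 24 counts four positive pieces, each of mass at most 3 times the norm, and the 2 of
    [pos_trace_bound]. *)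
Lemma iter_shift_bound rho : growth rho -> exists2 K, 0 <= K &
  forall n t a, Normc.normc (iter n S t a) <= K * rho ^+ n * trace_norm t * cnorm a.
Proof.
move=> [rho0 [K K0 hK]]; exists (24 * K); first exact: mulr_ge0.
move=> n t a; have rn : 0 <= rho ^+ n by exact: exprn_ge0.
have a0 := cnorm_ge0 a; have t0 := trace_norm_ge0 t.
have [p1 [p2 [p3 [p4 [te [P1 P2 P3 P4] [m1 m2 m3 m4]]]]]] := trace_decomposition Bc t.
have hp p : pos_trace p -> mass p <= 3 * trace_norm t ->
    Normc.normc (iter n S p a) <= 6 * K * rho ^+ n * trace_norm t * cnorm a.
  move=> pp pm; rewrite (le_trans (pos_trace_bound a (iter_shift_pos n pp)))//.
  rewrite ler_wpM2r//.
  rewrite (le_trans (y := 2 * (K * rho ^+ n * mass p)))//.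
    by rewrite ler_wpM2l// hK.
  rewrite (le_trans (y := 2 * (K * rho ^+ n * (3 * trace_norm t))))//.
    by rewrite ler_wpM2l// ler_wpM2l// mulr_ge0.
  by rewrite le_eqVlt; apply/orP; left; apply/eqP; ring.
have e1 : iter n S t a = iter n S p1 a - iter n S p2 a
    + 'i * (iter n S p3 a - iter n S p4 a).
  by rewrite !iter_shiftE te trace_addE trace_scaleE !trace_addE !trace_oppE.
rewrite e1 (le_trans (le_normcD _ _))//.
rewrite [X in _ + X]Normc.normcM normci mul1r.
rewrite (le_trans (lerD (le_normcD _ _) (le_normcD _ _)))// !normcN.
have := hp _ P1 m1; have := hp _ P2 m2; have := hp _ P3 m3; have := hp _ P4 m4.
rewrite -!mulrA; move: (K * _); move=> X; lra.
Qed.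

(** * Neumann series, with [q] the inverse of the spectral parameter *)

Section Neumann.
Variables (q : R[i]) (rho : R).
Hypotheses (grho : growth rho) (qrho : Normc.normc q * rho < 1).

Let psum t n a := \sum_(i < n) q ^+ i * iter i S t a.

Let normcX (z : R[i]) n : Normc.normc (z ^+ n) = Normc.normc z ^+ n.
Proof.
elim: n => [|n IH]; first by rewrite !expr0 Normc.normc1.
by rewrite !exprS Normc.normcM IH.
Qed.

Let normc_sum n (F : 'I_n -> R[i]) :
  Normc.normc (\sum_(i < n) F i) <= \sum_(i < n) Normc.normc (F i).
Proof.
elim/big_rec2: _ => [|i x y _ h]; first by rewrite Normc.normc0.
by rewrite (le_trans (le_normcD _ _))// lerD2l.
Qed.

Let x := Normc.normc q * rho.
Let x0 : 0 <= x. Proof. by rewrite mulr_ge0 ?normc_ge0//; case: grho. Qed.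

Let geom n : \sum_(i < n) x ^+ i <= (1 - x)^-1.
Proof.
have d0 : 0 < 1 - x by rewrite subr_gt0.
rewrite -[leRHS]mul1r ler_pdivlMr//.
have -> : (\sum_(i < n) x ^+ i) * (1 - x) = 1 - x ^+ n.
  elim: n => [|n IH]; first by rewrite big_ord0 mul0r expr0 subrr.
  by rewrite big_ord_recr/= mulrDl IH exprSr; ring.
by rewrite gerBl exprn_ge0.
Qed.

(** Powers of [x] decrease, so [n x^n] is at most the partial geometric sum, hence at most
    [1 / (1 - x)]. *)
Let geom_small (M e : R) : 0 <= M -> 0 < e ->
  exists m, forall n, (m <= n)%N -> x ^+ n * M <= e.
Proof.
move=> M0 e0; have d0 : 0 < 1 - x by rewrite subr_gt0.
pose y := M / ((1 - x) * e); exists (Num.trunc y).+1 => n mn.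
have yn : y <= n%:R.
  rewrite ltW// (lt_le_trans (@truncnS_gt _ y))// ler_nat //.
have n0 : 0 < n%:R :> R by rewrite ltr0n (leq_trans _ mn).
have nx : n%:R * x ^+ n <= (1 - x)^-1.
  apply: le_trans (geom n); rewrite mulr_natl -[n in _ *+ n]card_ord -sumr_const.
  by apply: ler_sum => i _; rewrite ler_wiXn2l ?(ltW qrho)// ltnW.
have xn : x ^+ n <= (1 - x)^-1 / n%:R by rewrite ler_pdivlMr// mulrC.
rewrite (le_trans (ler_wpM2r M0 xn))// mulrAC ler_pdivrMr// mulrC ler_pdivrMr//.
move: yn; rewrite /y ler_pdivrMr ?mulr_gt0//.
by rewrite [(1 - x) * e]mulrC mulrA [n%:R * e]mulrC.
Qed.

Let term_bound : exists2 K, 0 <= K & forall t n a,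
  Normc.normc (q ^+ n * iter n S t a) <= x ^+ n * (K * trace_norm t * cnorm a).
Proof.
have [K K0 hK] := iter_shift_bound grho.
exists K => // t n a; rewrite Normc.normcM normcX /x exprMn -[leRHS]mulrA.
rewrite ler_wpM2l ?exprn_ge0 ?normc_ge0// (le_trans (hK _ _ _))//.
by rewrite le_eqVlt; apply/orP; left; apply/eqP; ring.
Qed.

Let psum_bound : exists2 K, 0 <= K & forall t n a,
  Normc.normc (psum t n a) <= K * trace_norm t * cnorm a.
Proof.
have [K K0 hK] := term_bound.
have d0 : 0 <= (1 - x)^-1 by rewrite invr_ge0 subr_ge0 ltW.
exists ((1 - x)^-1 * K); first exact: mulr_ge0.
move=> t n a; rewrite (le_trans (normc_sum _))//.
rewrite (le_trans (ler_sum _ (fun (i : 'I_n) _ => hK t i a)))// -mulr_suml.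
rewrite -!mulrA ler_wpM2r ?geom//.
by rewrite !mulr_ge0 ?trace_norm_ge0 ?cnorm_ge0.
Qed.

Let bdd_psum t a : bdd_seq (fun n => psum t n a).
Proof. by have [K K0 hK] := psum_bound; eexists => n; exact: hK. Qed.

(** The series is summed at each element by [ulim], through which linearity, the trace property and
    positivity pass from the partial sums. *)
Let f t a : R[i]^o := ulim (fun n => psum t n a).

Let f_trace t : bounded_trace (f t).
Proof.
split.
- move=> c a b; rewrite scale_regE -ulimD; [|exact: bdd_psum|exact: bdd_psum].
  congr ulim; apply/funext => n; rewrite mulr_sumr -big_split /=.
  by apply: eq_bigr => i _; rewrite linearD linearZ /= scale_regE; ring.
- have [K K0 hK] := psum_bound.
  exists (K * trace_norm t + K * trace_norm t) => a.
  by rewrite mulrDl; apply: ulim_norm => n; exact: hK.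
- move=> a b; congr ulim; apply/funext => n.
  by apply: eq_bigr => i _; rewrite trace_comm.
Qed.

Let N t := mk_trace (f_trace t).
Let NE t a : N t a = ulim (fun n => psum t n a). Proof. by []. Qed.

Let N_linear : linear N.
Proof.
move=> c t p; apply: trace_ext => a; rewrite trace_addE trace_scaleE !NE.
rewrite -ulimD; [|exact: bdd_psum|exact: bdd_psum].
congr ulim; apply/funext => n; rewrite mulr_sumr -big_split /=.
apply: eq_bigr => i _.
rewrite !iter_shiftE trace_addE trace_scaleE; ring.
Qed.

(** Telescoping: the partial sum minus [q * s n] is [t a] minus a term tending to 0. Both inverse
    identities follow, with [s] the partial sums of [S t] at [a], or of [t] at [phi a]. *)
Let psum_tail t a (s : nat -> R[i]) : bdd_seq s ->
  (forall n, q * s n = psum t n.+1 a - t a) -> N t a - q * ulim s = t a.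
Proof.
move=> bs hs; have [K K0 hK] := term_bound.
rewrite NE -mulNr addrC -ulimD//.
have -> : (fun n => - q * s n + psum t n a) = (fun n => t a - q ^+ n * iter n S t a).
  apply/funext => n; rewrite mulNr hs /psum big_ord_recr /=; ring.
apply: ulim_cvg => e e0.
have M0 : 0 <= K * trace_norm t * cnorm a by rewrite !mulr_ge0 ?trace_norm_ge0 ?cnorm_ge0.
have : exists m, forall n, (m <= n)%N -> x ^+ n * (K * trace_norm t * cnorm a) <= e.
  exact: geom_small.
move=> [m hm]; exists m => n /hm; apply: le_trans.
by rewrite addrAC subrr add0r normcN hK.
Qed.

Lemma neumann : exists N : T -> T,
  [/\ linear N, exists2 M, 0 <= M & forall t, trace_norm (N t) <= M * trace_norm t,
      forall t, N (t - q *: S t) = t, forall t, N t - q *: S (N t) = t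
    & 0 <= q -> forall t, pos_trace t -> pos_trace (N t)].
Proof.
exists N; split.
- exact: N_linear.
- have [K K0 hK] := psum_bound; exists (K + K); first exact: addr_ge0.
  move=> t; apply: trace_norm_le_of; first by rewrite mulr_ge0 ?addr_ge0 ?trace_norm_ge0.
  move=> a; rewrite -mulrA mulrDl mulrA; apply: ulim_norm => n; exact: hK.
- move=> t; apply: trace_ext => a.
  have -> : N (t - q *: S t) = - q *: N (S t) + N t.
    by rewrite -N_linear scaleNr addrC.
  rewrite trace_addE trace_scaleE addrC mulNr (NE (S t)).
  apply: psum_tail; first exact: bdd_psum.
  move=> n; rewrite /psum big_ord_recl /= expr0 mul1r addrC addKr mulr_sumr.
  by apply: eq_bigr => i _; rewrite -iterSr exprS mulrA.
- move=> t; apply: trace_ext => a; rewrite trace_addE trace_oppE trace_scaleE SE.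
  rewrite (NE t (phi a)); apply: psum_tail; first exact: bdd_psum.
  move=> n; rewrite /psum big_ord_recl /= expr0 mul1r addrC addKr mulr_sumr.
  by apply: eq_bigr => i _; rewrite -SE exprS mulrA.
- move=> q0 t tp a pa; rewrite NE; apply: ulim_ge0; first exact: bdd_psum.
  move=> n; apply: sumr_ge0 => i _; rewrite mulr_ge0 ?exprn_ge0//.
  exact: iter_shift_pos.
Qed.

End Neumann.
End PerronFrobenius.

Section LinearPredicate.
Variables (K : pzRingType) (U V : lmodType K) (f : U -> V).
Hypothesis fl : linear f.

Lemma linear_fun0 : f 0 = 0.
Proof.
by apply: (addrI (f 0)); have := fl 1 0 0; rewrite !scale1r !addr0 => <-.
Qed.

Lemma linear_funD x y : f (x + y) = f x + f y.
Proof. by have := fl 1 x y; rewrite !scale1r. Qed.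

Lemma linear_funZ c x : f (c *: x) = c *: f x.
Proof. by have := fl c x 0; rewrite !addr0 linear_fun0 addr0. Qed.

Lemma linear_funB x y : f (x - y) = f x - f y.
Proof.
by apply/eqP; rewrite eq_sym subr_eq -linear_funD subrK.
Qed.

End LinearPredicate.

(** * A tracial eigenstate at the growth rate *)

Section Eigenstate.
Context {R : realType} {B : preCStarAlgType R}.
Hypothesis Bc : cauchy_complete B.
Local Open Scope complex_scope.
Notation T := (trace_space B).
Implicit Types (t p u : T) (a : B) (r : R) (q : R[i]).

Variables (S : T -> T) (phi : B -> B).
Hypothesis SE : forall t a, S t a = t (phi a).
Hypothesis S_pos : forall t, pos_trace t -> pos_trace (S t).

Let rad := growth_rate S.
Hypothesis rad0 : 0 < rad.

(* If the resolvent [N] at [lam = rad + d] multiplied masses by at most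
   [C = lam / (2 * d)], then [mass (N (S^n t))] would shrink by the factor
   [lam * (1 - C^-1) = rad - d] at each step, contradicting the choice of [rad]. *)
Lemma resolvent_mass_unbounded (d : R) (N : T -> T) : 0 < d -> d <= rad / 2 ->
  linear N -> (forall t, pos_trace t -> pos_trace (N t)) ->
  (forall t, N (t - (rad + d)^-1%:C *: S t) = t) ->
  exists t, pos_trace t /\ (rad + d) / (2 * d) * mass t < mass (N t).
Proof.
move=> d0 dr Nl Np NK; apply: contrapT => /forallNP h.
pose lam := rad + d; have lam0 : 0 < lam by rewrite addr_gt0.
have {}h t : pos_trace t -> mass (N t) <= lam / (2 * d) * mass t.
  by move=> tp; rewrite leNgt; apply/negP => hh; apply: (h t).
have rd0 : 0 <= rad - d by move: rad0 dr; move: rad => z; lra.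
have : growth S (rad - d).
  split => //; exists (lam / (2 * d)).
    by rewrite mulr_ge0 ?invr_ge0 ?mulr_ge0// ltW.
  move=> n t tp; pose M k := mass (N (iter k S t)).
  have Sp k : pos_trace (iter k S t) by exact: iter_shift_pos.
  have M0 k : 0 <= M k by apply: mass_ge0; exact: Np.
  have mE k : mass (iter k S t) = M k - lam^-1 * M k.+1.
    rewrite -{1}(NK (iter k S t)) (linear_funB Nl) (linear_funZ Nl).
    by rewrite -scaleNr -(rmorphN (real_complex R)) massD massZ mulNr.
  have step k : M k.+1 <= (rad - d) * M k.
    have := h _ (Sp k); rewrite mE -/(M k) => hk.
    have h2 : 2 * d * M k <= lam * (M k - lam^-1 * M k.+1).
      by move: hk; rewrite mulrAC ler_pdivlMr ?mulr_gt0// mulrC.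
    move: h2; rewrite mulrBr mulrA mulfV ?gt_eqF// mul1r /lam.
    move: (rad) (M k) (M k.+1) => z x y; lra.
  have Mn k : M k <= (rad - d) ^+ k * M 0%N.
    elim: k => [|k IH]; first by rewrite expr0 mul1r.
    by rewrite (le_trans (step k))// exprS -mulrA ler_wpM2l.
  rewrite mE (le_trans (y := M n))//.
    by rewrite gerBl mulr_ge0// invr_ge0 ltW.
  rewrite (le_trans (Mn n))// [leRHS]mulrAC [leLHS]mulrC.
  by rewrite ler_wpM2r ?exprn_ge0//; exact: h.
move=> /(growth_rate_le SE S_pos); rewrite -/rad.
by move: d0; move: rad => z; lra.
Qed.

(** Normalise [N t] to [u], where [m = mass (N t)]. As [S (N t) = lam (N t - t)], the defect
    [S u - rad u] is [d u - (lam / m) t]. The first term contributes [2 d]; the second [4 d],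
    because [lam * mass t / m < 2 d]. This explains [e / 6]; the bound [rad / 2] is what
    [resolvent_mass_unbounded] asks for. *)
Lemma approx_eigenstate (e : R) : 0 < e -> exists u,
  [/\ pos_trace u, mass u = 1 &
      forall a, Normc.normc (S u a - rad%:C * u a) <= e * cnorm a].
Proof.
move=> e0; pose d := Num.min (rad / 2) (e / 6).
have d0 : 0 < d by rewrite lt_min !divr_gt0.
have dr : d <= rad / 2 by rewrite ge_min lexx.
have de : 6 * d <= e.
  by rewrite mulrC -ler_pdivlMr// ge_min lexx orbT.
pose lam := rad + d; have lam0 : 0 < lam by rewrite addr_gt0.
have rlt : growth_rate S < lam by rewrite ltrDl.
have [rho grho rlam] := growth_rate_lt SE S_pos rlt.
have qrho : Normc.normc (lam^-1%:C) * rho < 1.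
  by rewrite normcr ger0_norm ?invr_ge0 ?(ltW lam0)// mulrC ltr_pdivrMr// mul1r.
have [N [Nl _ NK NK' Np]] := neumann Bc SE S_pos grho qrho.
have {}Np := Np _; have q0 : 0 <= lam^-1%:C :> R[i] by rewrite ler0c invr_ge0 ltW.
have [t [tp tm]] := resolvent_mass_unbounded d0 dr Nl (Np q0) NK.
have t0 := mass_ge0 tp; set m := mass (N t) in tm.
have m0 : 0 < m.
  by apply: le_lt_trans tm; rewrite mulr_ge0// mulr_ge0 ?invr_ge0 ?mulr_ge0// ltW.
have up : pos_trace (m^-1%:C *: N t).
  by apply: pos_traceZ; [rewrite invr_ge0 ltW|exact: Np].
have um : mass (m^-1%:C *: N t) = 1 by rewrite massZ mulVf// gt_eqF.
exists (m^-1%:C *: N t); split => // a.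
have SN : S (N t) a = lam%:C * (N t a - t a).
  have /(congr1 (fun s : T => s a)) := NK' t.
  rewrite trace_addE trace_oppE trace_scaleE => <-.
  by rewrite opprB addrC subrK mulrA -rmorphM mulfV ?gt_eqF// mul1r.
have -> : S (m^-1%:C *: N t) a - rad%:C * (m^-1%:C *: N t : T) a
    = d%:C * (m^-1%:C *: N t : T) a + - (lam / m)%:C * t a.
  rewrite SE !trace_scaleE -SE SN /lam !rmorphM !rmorphD /=.
  ring.
rewrite (le_trans (le_normcD _ _))// Normc.normcM [X in _ + X]Normc.normcM normcN !normcr.
rewrite !ger0_norm ?divr_ge0 ?(ltW d0) ?(ltW m0) ?(ltW lam0)//.
have hu := pos_trace_bound a up; have ht := pos_trace_bound a tp.
rewrite um mulr1 in hu.
have c0 := cnorm_ge0 a.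
rewrite (le_trans (lerD (ler_wpM2l (ltW d0) hu) (ler_wpM2l _ ht)))//.
  by rewrite divr_ge0// ltW.
have lm : lam / m * mass t <= 2 * d.
  rewrite mulrAC ler_pdivrMr// -ler_pdivrMl ?mulr_gt0// mulrA.
  by rewrite [_^-1 * _]mulrC; exact: ltW.
rewrite (_ : lam / m * _ = (lam / m * mass t) * (2 * cnorm a)); last by ring.
rewrite (le_trans (y := d * (2 * cnorm a) + 2 * d * (2 * cnorm a)))//.
  by rewrite lerD2l ler_wpM2r// mulr_ge0.
rewrite (_ : _ + _ = 6 * d * cnorm a); last by ring.
by rewrite ler_wpM2r.
Qed.

Let us_ex n : exists u, [/\ pos_trace u, mass u = 1 &
  forall a, Normc.normc (S u a - rad%:C * u a) <= n.+1%:R^-1 * cnorm a].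
Proof. by apply: approx_eigenstate; rewrite invr_gt0. Qed.

Let us n := sval (cid (us_ex n)).
Let us_pos n : pos_trace (us n). Proof. by rewrite /us; case: cid => ? []. Qed.
Let us_mass n : mass (us n) = 1. Proof. by rewrite /us; case: cid => ? []. Qed.
Let us_eig n a : Normc.normc (S (us n) a - rad%:C * us n a) <= n.+1%:R^-1 * cnorm a.
Proof. by rewrite /us; case: cid => ? []. Qed.

Let us_bound n a : Normc.normc (us n a) <= 2 * cnorm a.
Proof. by have := pos_trace_bound a (us_pos n); rewrite us_mass mulr1. Qed.

Let us_bdd a : bdd_seq (fun n => us n a).
Proof. by exists (2 * cnorm a) => n; exact: us_bound. Qed.

Let f a : R[i]^o := ulim (fun n => us n a).

Let f_trace : bounded_trace f.
Proof.
split.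
- move=> c a b; rewrite scale_regE -ulimD; [|exact: us_bdd|exact: us_bdd].
  by congr ulim; apply/funext => n; rewrite linearD linearZ /= scale_regE.
- exists (2 + 2) => a; rewrite mulrDl; apply: ulim_norm => n; exact: us_bound.
- by move=> a b; congr ulim; apply/funext => n; rewrite trace_comm.
Qed.

(** The approximate eigenstates all take the value 1 at the unit, so their ultralimit does too. The
    eigenvalue equation at [a] compares the limits at [phi a] and at [a], and the errors vanish. *)
Lemma eigenstate : exists2 u : T, tracial_state u & S u = rad%:C *: u.
Proof.
exists (mk_trace f_trace).
  split; first apply/(pos_traceP Bc).
    by move=> a pa; apply: ulim_ge0 => // n; exact: us_pos.
  transitivity (ulim (fun n => us n 1)); first by [].
  rewrite -[RHS](@ulim_cst R 1).
  by congr ulim; apply/funext => n; rewrite pos_trace_mass// us_mass.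
apply: trace_ext => a; rewrite SE trace_scaleE.
apply/eqP; rewrite -subr_eq0; apply/eqP.
rewrite [X in X - _](_ : _ = ulim (fun n => us n (phi a)))//.
rewrite [X in _ - _ * X](_ : _ = ulim (fun n => us n a))//.
rewrite -mulNr addrC -ulimD//; apply: ulim_cvg => e e0.
have c1 : 0 < cnorm a + 1 by rewrite ltr_wpDl ?cnorm_ge0.
exists (Num.trunc (e^-1 * (cnorm a + 1))) => n Nn.
rewrite subr0 mulNr addrC -SE (le_trans (us_eig n a))//.
rewrite mulrC ler_pdivrMr// -ler_pdivrMl// (le_trans (y := e^-1 * (cnorm a + 1)))//.
  by rewrite ler_wpM2l ?invr_ge0 ?(ltW e0)// lerDl.
by rewrite (le_trans (ltW (@truncnS_gt _ _)))// ler_nat.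
Qed.

End Eigenstate.

(** * Growth rates as bounds on the spectrum *)

Section SpectralRadii.
Context {R : realType} {B : preCStarAlgType R}.
Hypothesis Bc : cauchy_complete B.
Local Open Scope complex_scope.
Notation T := (trace_space B).
Implicit Types (t p u : T) (a : B) (r : R) (q l : R[i]).

Lemma continuous_of_bound (f : {linear T -> T}) (M : R) :
  (forall t, trace_norm (f t) <= M * trace_norm t) -> continuous f.
Proof.
move=> fM; apply/bounded_linear_continuous/bounded_funP => s.
exists (`|M|%:C * s) => t ts.
have h : `|f t| <= `|M|%:C * `|t|.
  rewrite [`|f t|]/(_%:C) [`|t|]/(_%:C) -rmorphM lecR (le_trans (fM t))//.
  by rewrite ler_wpM2r ?trace_norm_ge0// ler_norm.
by rewrite (le_trans h)// ler_wpM2l// ler0c.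
Qed.

Lemma trace_norm_scale_le c t :
  trace_norm (c *: t) <= Normc.normc c * trace_norm t.
Proof.
apply: trace_norm_le_of; first by rewrite mulr_ge0 ?normc_ge0 ?trace_norm_ge0.
by move=> a; rewrite trace_scaleE Normc.normcM -mulrA ler_wpM2l ?normc_ge0 ?trace_normP.
Qed.

Lemma resolvent_of_bound (S N : T -> T) l (M : R) : linear N ->
  (forall t, trace_norm (N t) <= M * trace_norm t) ->
  (forall t, N (S t - l *: t) = t) -> (forall t, S (N t) - l *: N t = t) ->
  resolvent_set S l.
Proof.
move=> Nl NM NK NK'.
pose N' := HB.pack_for {linear T -> T} N (GRing.isLinear.Build _ _ _ _ N Nl).
by exists N'; [exact: (continuous_of_bound (f := N') NM)|split].
Qed.

Lemma eigenvalue_in_spectrum (S : T -> T) l u : tracial_state u ->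
  S u = l *: u -> spectrum S l.
Proof.
move=> [_ u1] Su [r _ [rK _]].
have := rK u; rewrite /= Su subrr linear0 => u0.
by move: u1; rewrite -u0 => /eqP; rewrite eq_sym oner_eq0.
Qed.

Variables (S S' : T -> T) (phi phi' : B -> B).
Hypothesis SE : forall t a, S t a = t (phi a).
Hypothesis S_pos : forall t, pos_trace t -> pos_trace (S t).
Hypothesis SE' : forall t a, S' t a = t (phi' a).
Hypothesis S_pos' : forall t, pos_trace t -> pos_trace (S' t).
Hypothesis SK : cancel S S'.
Hypothesis SK' : cancel S' S.
Hypothesis state_ex : exists t : T, tracial_state t.

(** Applying [S] and then [S'] [n] times each returns the given state, so [1 <= K (C rho)^n] for all
    [n], where [C] bounds the mass growth of [S']. This forces [C rho >= 1] for every [rho] in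
    [growth S]. *)
Lemma growth_rate_gt0 : 0 < growth_rate S.
Proof.
have [t [/(pos_traceP Bc) tp t1]] := state_ex.
have m1 : mass t = 1 by rewrite /mass t1.
pose C := 2 * cnorm (phi' 1) + 1.
have C0 : 0 < C by exact: shift_const_gt0.
apply: (@lt_le_trans _ _ C^-1); first by rewrite invr_gt0.
apply: lb_le_inf; first by case: (has_inf_growth SE S_pos).
move=> rho [rho0 [K K0 hK]]; rewrite leNgt; apply/negP => h.
have key n : 1 <= K * (C * rho) ^+ n.
  have sp := iter_shift_pos S_pos n tp.
  have := iter_shift_mass SE' S_pos' n sp.
  have -> : iter n S' (iter n S t) = t.
    by elim: n {sp} => // n IH; rewrite iterSr iterS SK IH.
  rewrite m1 -/C => /le_trans; apply.
  have := hK n t tp; rewrite m1 mulr1 exprMn mulrCA => h1.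
  by rewrite ler_wpM2l ?exprn_ge0 ?(ltW C0).
have x1 : C * rho < 1 by rewrite mulrC -ltr_pdivlMr// div1r.
have x0 : 0 <= C * rho by rewrite mulr_ge0// ltW.
(* For [x = C * rho < 1] one has [n x^n (1 - x) <= 1]; together with [1 <= K x^n] this bounds
   [n (1 - x)] uniformly in [n], which is absurd. *)
have xn n : n%:R * (1 - C * rho) <= K.
  move: (C * rho) x0 x1 key => x x0 x1 key.
  have d0 : 0 < 1 - x by rewrite subr_gt0.
  have nx : n%:R * x ^+ n * (1 - x) <= 1.
    have : (\sum_(i < n) x ^+ i) * (1 - x) <= 1.
      have -> : (\sum_(i < n) x ^+ i) * (1 - x) = 1 - x ^+ n.
        elim: n => [|n IH]; first by rewrite big_ord0 mul0r expr0 subrr.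
        by rewrite big_ord_recr/= mulrDl IH exprSr; ring.
      by rewrite gerBl exprn_ge0.
    apply: le_trans; rewrite ler_wpM2r ?(ltW d0)//.
    rewrite mulr_natl -[n in _ *+ n]card_ord -sumr_const.
    by apply: ler_sum => i _; rewrite ler_wiXn2l ?(ltW x1)// ltnW.
  have n0 : 0 <= n%:R * (1 - x) by rewrite mulr_ge0 ?ler0n// ltW.
  have := ler_wpM2l n0 (key n); rewrite mulr1 => /le_trans; apply.
  rewrite mulrCA -[leRHS]mulr1 ler_wpM2l//.
  by rewrite mulrAC.
have := xn (Num.trunc (K / (1 - C * rho))).+1.
by rewrite -ler_pdivlMr ?subr_gt0// leNgt truncnS_gt.
Qed.

(** Factor [S - l = - l (1 - l^-1 S)] and invert the second factor by [neumann]. *)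
Lemma spectrum_le_growth_rate l : spectrum S l ->
  Normc.normc l <= growth_rate S.
Proof.
apply: contra_notP => /negP; rewrite -ltNge => h.
have [rho grho rl] := growth_rate_lt SE S_pos h.
have nl0 : 0 < Normc.normc l by apply: le_lt_trans h; exact: growth_rate_ge0 SE S_pos.
have l0 : l != 0 by apply: contraTneq nl0 => ->; rewrite Normc.normc0 ltxx.
have qrho : Normc.normc l^-1 * rho < 1.
  by rewrite Normc.normcV mulrC ltr_pdivrMr// mul1r.
have [N [Nl [M M0 NM] NK NK' _]] := neumann Bc SE S_pos grho qrho.
have shift t : S t - l *: t = (- l) *: (t - l^-1 *: S t).
  by rewrite scalerBr !scaleNr scalerA mulfV// scale1r opprK addrC.
apply: (@resolvent_of_bound S (fun t => - l^-1 *: N t) l (Normc.normc l^-1 * M)).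
- move=> c t p; rewrite Nl scalerDr !scalerA; congr (_ *: _ + _); exact: mulrC.
- move=> t; rewrite (le_trans (trace_norm_scale_le _ _))// normcN -mulrA.
  by rewrite ler_wpM2l ?normc_ge0.
- move=> t; rewrite shift (linear_funZ Nl) scalerA mulrN mulNr opprK mulVf// scale1r NK//.
- move=> t; rewrite shift (linear_funZ (shift_linear SE)) scalerA [_ * - _]mulrC -scalerA.
  by rewrite -scalerBr NK' scalerA mulNr mulrN opprK mulfV// scale1r.
Qed.

(** Factor [S - l = S (1 - l S')], so the inverse is [N] after [S'], with [N] from [neumann] for
    [S'] at [q = l]. For [l = 0] any growth bound of [S'] will do. *)
Lemma spectrum_ge_inv_growth_rate l : spectrum S l ->
  (growth_rate S')^-1 <= Normc.normc l.
Proof.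
apply: contra_notP => /negP; rewrite -ltNge => h.
have g0 : 0 < growth_rate S'.
  by rewrite -invr_gt0; apply: le_lt_trans h; exact: normc_ge0.
have [rho grho rl] : exists2 rho, growth S' rho & Normc.normc l * rho < 1.
  have [l0|l0] := eqVneq (Normc.normc l) 0.
    have [|rho grho _] := growth_rate_lt SE' S_pos' (r := growth_rate S' + 1).
      by rewrite ltrDl.
    by exists rho => //; rewrite l0 mul0r.
  have nl0 : 0 < Normc.normc l by rewrite lt_neqAle eq_sym l0 normc_ge0.
  have [|rho grho hr] := growth_rate_lt SE' S_pos' (r := (Normc.normc l)^-1).
    by rewrite -[ltLHS]invrK ltf_pV2// posrE invr_gt0.
  by exists rho => //; rewrite mulrC -ltr_pdivlMr// div1r.
have Sl := shift_linear SE; have Sl' := shift_linear SE'.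
have [N [Nl [M M0 NM] NK NK' _]] := neumann Bc SE' S_pos' grho rl.
have [K K0 hK] := iter_shift_bound Bc SE' S_pos' grho.
have SM t : trace_norm (S' t) <= K * rho * trace_norm t.
  have rho0 : 0 <= rho by case: grho.
  apply: trace_norm_le_of; first by rewrite !mulr_ge0 ?trace_norm_ge0.
  exact: hK 1%N t.
apply: (@resolvent_of_bound S (fun t => N (S' t)) l (M * (K * rho))).
- by move=> c t p; rewrite Sl' Nl.
- by move=> t; rewrite (le_trans (NM _))// -mulrA ler_wpM2l.
- by move=> t; rewrite (linear_funB Sl') (linear_funZ Sl') SK NK.
- move=> t; rewrite -{2}[N (S' t)]SK' -(linear_funZ Sl) -(linear_funB Sl) NK'.
  exact: SK'.
Qed.

End SpectralRadii.

(** An eigenstate of [S'] for [r'] is one of [S] for [r'^-1], so the lower spectral bound is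
    attained, just as the upper one is attained at [r]. *)
Lemma extremal_eigenstates (R : realType) (B : preCStarAlgType R)
  (S S' : trace_space B -> trace_space B) (phi phi' : B -> B) :
  cauchy_complete B ->
  (forall t a, S t a = t (phi a)) ->
  (forall t, pos_trace t -> pos_trace (S t)) ->
  (forall t a, S' t a = t (phi' a)) ->
  (forall t, pos_trace t -> pos_trace (S' t)) ->
  cancel S S' -> cancel S' S ->
  (exists t : trace_space B, tracial_state t) ->
  exists rmin rmax : R[i],
    [/\ is_rmin S rmin, is_rmax S rmax,
        exists2 t1, tracial_state t1 & S t1 = rmin *: t1
      & exists2 t2, tracial_state t2 & S t2 = rmax *: t2].
Proof.
move=> Bc SE S_pos SE' S_pos' SK SK' st.
have r0 := growth_rate_gt0 Bc SE S_pos SE' S_pos' SK st.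
have r0' := growth_rate_gt0 Bc SE' S_pos' SE S_pos SK' st.
have [u2 us2 ue2] := eigenstate Bc SE S_pos r0.
have [u1 us1 ue1] := eigenstate Bc SE' S_pos' r0'.
set r := growth_rate S in r0 ue2; set r' := growth_rate S' in r0' ue1.
have {}ue1 : S u1 = r'^-1%:C%C *: u1.
  have e : r'%:C%C *: S u1 = u1.
    by rewrite -(linear_funZ (shift_linear SE)) -ue1 SK'.
  by rewrite -[in RHS]e scalerA -rmorphM mulVf ?gt_eqF// scale1r.
have normE (x : R) : 0 < x -> `|x%:C%C : R[i]| = x%:C%C.
  by move=> x0; rewrite ger0_norm// ler0c ltW.
exists r'^-1%:C%C, r%:C%C; split.
- split.
    exists r'^-1%:C%C; [exact: eigenvalue_in_spectrum us1 ue1|by rewrite normE ?invr_gt0].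
  move=> _ [l /(spectrum_ge_inv_growth_rate Bc SE SE' S_pos' SK SK') h <-].
  by rewrite [`|l|]/((Normc.normc l)%:C%C) lecR.
- split.
    exists r%:C%C; [exact: eigenvalue_in_spectrum us2 ue2|by rewrite normE].
  move=> _ [l /(spectrum_le_growth_rate Bc SE S_pos) h <-].
  by rewrite [`|l|]/((Normc.normc l)%:C%C) lecR.
- by exists u1.
- by exists u2.
Qed.

(** * Spectral subspaces and row frames *)

Section Completeness.
Context {R : realType} (A : cstarAlgType R).
Local Open Scope complex_scope.

Lemma cstar_cauchy_complete : cauchy_complete A.
Proof.
move=> u uC; pose v : nat -> normed_space A := u.
have : cvg (v @ \oo).
  apply: cstar_complete; apply/cauchy_ballP => e e0.
  (* The radius [e] is complex; being positive it is real, and half of its real part serves as a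
     real radius. *)
  have [r r0 re] : exists2 r : R, 0 < r & r%:C < e.
    exists (complex.Re e / 2); first by move: e0; rewrite ltcE => /andP[_ h]; rewrite divr_gt0.
    move: e0; rewrite !ltcE /= => /andP[-> h]; lra.
  have [N HN] := uC _ r0.
  pose tail := [set v n | n in [set n | (N <= n)%N]].
  have vtail : (v @ \oo) tail by exists N => // n Nn; exists n.
  exists (tail, tail) => //= -[_ _] [/= [m Nm <-] [n Nn <-]].
  rewrite -ball_normE /=.
  by apply: le_lt_trans re; rewrite [leLHS]/(_%:C) lecR; exact: HN.
move=> /cvg_ex[l vl]; exists l => e e0.
have /cvgrPdist_le /(_ e%:C) := vl; rewrite ltcR => /(_ e0) [N _ HN].
exists N => n /HN; rewrite [leLHS]/(_%:C) lecR => h.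
by rewrite cnorm_distC.
Qed.

Variable g : circle_action A.
Notation ssub := (spectral_subspace g).

Lemma circ_act_one z : `|z| = 1 -> g z 1 = 1.
Proof.
move=> z1; have := fixed_valP (1 : fixed_alg g) z1.
by rewrite fixed_val1 expr0z scale1r.
Qed.

(** With [n = cnorm a], write [n^2 - star a * a = k * k]. The image of this under [g z] is
    [star (g z k) * g z k], which is positive, so [star (g z a) * g z a] has norm at most [n^2]. *)
Lemma circ_act_cnorm_le z a : `|z| = 1 -> cnorm (g z a) <= cnorm a.
Proof.
move=> z1; have Ac := cstar_cauchy_complete.
have gl := circ_act_linear g z1.
set n := cnorm a; have n0 : 0 <= n := cnorm_ge0 a.
have [k [/pos_herm kh kk _]] : exists k, [/\ pos k,
    k * k = (n ^+ 2)%:C%:A - star a * a & forall b, b * ((n ^+ 2)%:C%:A - star a * a) =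
      ((n ^+ 2)%:C%:A - star a * a) * b -> b * k = k * b].
  apply: pos_sqrt => //; apply: pos_scalarB; first by rewrite starM starK.
  by rewrite cnorm_starM.
rewrite -(@ler_pXn2r _ 2) ?nnegrE ?cnorm_ge0// -cnorm_starM.
apply: pos_cnorm_le => //; [exact: exprn_ge0|exact: star_mul_pos|].
have -> : (n ^+ 2)%:C%:A - star (g z a) * g z a = star (g z k) * g z k.
  rewrite -!circ_act_star// kh -!circ_act_mul// kk (linear_funB gl) (linear_funZ gl).
  by rewrite circ_act_one.
exact: star_mul_pos.
Qed.

(** By contractivity [g z a] is again a limit of the fixed sequence, so it equals [a] by
    uniqueness. *)
Lemma fixed_alg_cauchy_complete : cauchy_complete (fixed_alg g).
Proof.
move=> u uC; have [a ua] : exists a, cto (fun n => fixed_val (u n)) a.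
  exact: cstar_cauchy_complete uC.
have a0 : ssub 0 a.
  move=> z z1; rewrite expr0z scale1r; apply/esym; apply: (cto_uniq ua) => e e0.
  have [N HN] := ua _ e0; exists N => n /HN; apply: le_trans.
  have {1}-> : fixed_val (u n) = g z (fixed_val (u n)).
    by rewrite fixed_valP// expr0z scale1r.
  by rewrite -(linear_funB (circ_act_linear g z1)) circ_act_cnorm_le.
by exists (Sub_fixed a0).
Qed.

(** [pos] speaks only of star, norm and scalars, all inherited from [A]. *)
Lemma pos_fixed_val (a : fixed_alg g) : pos a <-> pos (fixed_val a).
Proof.
split=> -[ah [c c0 ac]]; split; [|by exists c| |by exists c].
  by rewrite -fixed_val_star ah.
by apply: fixed_val_inj; rewrite fixed_val_star.
Qed.

Lemma ssubD k a b : ssub k a -> ssub k b -> ssub k (a + b).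
Proof.
move=> ha hb z z1; rewrite (linear_funD (circ_act_linear g z1)) ha// hb//.
by rewrite scalerDr.
Qed.

Lemma ssub_scale k c a : ssub k a -> ssub k (c *: a).
Proof.
move=> ha z z1; rewrite (linear_funZ (circ_act_linear g z1)) ha//.
by rewrite !scalerA mulrC.
Qed.

Lemma ssub_sum k n (F : 'I_n -> A) : (forall i, ssub k (F i)) ->
  ssub k (\sum_(i < n) F i).
Proof.
move=> h; apply: big_ind => //; last exact: ssubD.
by move=> z z1; rewrite (linear_fun0 (circ_act_linear g z1)) scaler0.
Qed.

Lemma ssubM k l a b : ssub k a -> ssub l b -> ssub (k + l) (a * b).
Proof.
move=> ha hb z z1; rewrite circ_act_mul// ha// hb// -scalerAl -scalerAr scalerA.
by rewrite expfzDr// -normr_eq0 z1 oner_eq0.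
Qed.

Lemma ssub_star k a : ssub k a -> ssub (- k) (star a).
Proof.
move=> ha z z1; rewrite circ_act_star// ha// starZ -invr_expz; congr (_ *: _).
have zk : `|z ^ k| = 1 by case: (k) => m; rewrite /exprz ?normfV normrX z1 expr1n ?invr1.
have zk0 : z ^ k != 0 by rewrite -normr_eq0 zk oner_eq0.
by apply: (mulfI zk0); rewrite divff// -sqr_normc zk expr1n.
Qed.

(** Not the averaging projection: outside [ssub 0] it returns the default [0]. *)
Definition fix_part (a : A) : fixed_alg g := insubd (0 : fixed_alg g) a.

Lemma fix_partK a : ssub 0 a -> fixed_val (fix_part a) = a.
Proof. by move=> a0; apply: insubdK; exact: mem_set. Qed.

Lemma fixed_valK (a : fixed_alg g) : fix_part (fixed_val a) = a.
Proof. by apply: fixed_val_inj; rewrite fix_partK//; exact: fixed_valP. Qed.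

Lemma fix_part_sum n (F : 'I_n -> A) : (forall i, ssub 0 (F i)) ->
  fix_part (\sum_(i < n) F i) = \sum_(i < n) fix_part (F i).
Proof.
move=> h; apply: fixed_val_inj; rewrite fix_partK; last exact: ssub_sum.
by rewrite raddf_sum; apply: eq_bigr => i _; exact/esym/fix_partK.
Qed.

Lemma fix_partM a b : ssub 0 a -> ssub 0 b ->
  fix_part (a * b) = fix_part a * fix_part b.
Proof.
move=> a0 b0; apply: fixed_val_inj; rewrite fixed_valM !fix_partK//.
exact: (ssubM a0 b0).
Qed.

Lemma trace_fix_comm (t : trace_space (fixed_alg g)) a b :
  ssub 0 a -> ssub 0 b -> t (fix_part (a * b)) = t (fix_part (b * a)).
Proof. by move=> a0 b0; rewrite !fix_partM// trace_comm. Qed.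

Lemma trace_fix_sum (t : trace_space (fixed_alg g)) n (F : 'I_n -> A) :
  (forall i, ssub 0 (F i)) ->
  t (fix_part (\sum_(i < n) F i)) = \sum_(i < n) t (fix_part (F i)).
Proof. by move=> h; rewrite fix_part_sum// raddf_sum. Qed.

Definition row_frame (k : int) n (x : 'I_n -> A) : Prop :=
  (forall i, ssub k (x i)) /\ \sum_(i < n) x i * star (x i) = 1.

Section Compression.
Variables (k : int) (n : nat) (x : 'I_n -> A).
Hypothesis xk : row_frame k x.

Definition compress (a : A) : A := \sum_(i < n) star (x i) * a * x i.

Lemma ssub_entry i j a : ssub 0 a -> ssub 0 (star (x i) * a * x j).
Proof.
move=> a0; have [h _] := xk.
by have := ssubM (ssubM (ssub_star (h i)) a0) (h j); rewrite addr0 addNr.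
Qed.

Lemma ssub_compress a : ssub 0 a -> ssub 0 (compress a).
Proof. by move=> a0; apply: ssub_sum => i; exact: ssub_entry. Qed.

Lemma compress_pos a : pos a -> pos (compress a).
Proof.
move=> pa; apply: pos_sum => i; apply: pos_conj => //.
exact: cstar_cauchy_complete.
Qed.

Definition fix_compress (a : fixed_alg g) : fixed_alg g :=
  fix_part (compress (fixed_val a)).

Lemma fix_compressE a : fixed_val (fix_compress a) = compress (fixed_val a).
Proof. by rewrite fix_partK//; apply: ssub_compress; exact: fixed_valP. Qed.

Lemma fix_compress_pos a : pos a -> pos (fix_compress a).
Proof.
move=> /pos_fixed_val pa; apply/pos_fixed_val; rewrite fix_compressE.
exact: compress_pos.
Qed.

(** For the trace property, insert [1 = \sum_j x j * star (x j)] between [a] and [b]. The value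
    becomes a double sum of products of two degree-0 entries, which the trace may swap. *)
Lemma compress_trace (t : trace_space (fixed_alg g)) :
  bounded_trace (fun a => t (fix_compress a) : R[i]^o).
Proof.
split.
- move=> c a b; rewrite -linearP; congr (t _); apply: fixed_val_inj.
  rewrite fixed_val_linear !fix_compressE fixed_val_linear /compress.
  rewrite scaler_sumr -big_split /=; apply: eq_bigr => i _.
  by rewrite mulrDr mulrDl -scalerAr -scalerAl.
- exists (trace_norm t * \sum_(i < n) cnorm (star (x i)) * cnorm (x i)) => a.
  rewrite (le_trans (trace_normP _ _))// -mulrA ler_wpM2l ?trace_norm_ge0//.
  rewrite !fixed_cnormE fix_compressE (le_trans (cnorm_sum _ _))// mulr_suml.
  apply: ler_sum => i _; rewrite (le_trans (cnormM_le _ _))// mulrAC.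
  by rewrite ler_wpM2r ?cnorm_ge0// cnormM_le.
- have [h x1] := xk.
  have e (a b : fixed_alg g) : t (fix_compress (a * b)) =
      \sum_(i < n) \sum_(j < n) t (fix_part
        (star (x i) * fixed_val a * x j * (star (x j) * fixed_val b * x i))).
    have a0 := fixed_valP a; have b0 := fixed_valP b.
    rewrite /fix_compress trace_fix_sum; last first.
      by move=> i; apply: ssub_entry; exact: fixed_valP.
    apply: eq_bigr => i _; rewrite -trace_fix_sum; last first.
      by move=> j; exact: ssubM (ssub_entry _ _ a0) (ssub_entry _ _ b0).
    congr (t (fix_part _)); rewrite fixed_valM.
    transitivity (star (x i) * fixed_val a * (\sum_(j < n) x j * star (x j)) *
        (fixed_val b * x i)); first by rewrite x1 mulr1 !mulrA.
    rewrite mulr_sumr mulr_suml; apply: eq_bigr => j _; by rewrite !mulrA.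
  move=> a b; rewrite !e exchange_big; apply: eq_bigr => i _; apply: eq_bigr => j _.
  by apply: trace_fix_comm; apply: ssub_entry; exact: fixed_valP.
Qed.

End Compression.

(** The single factors lie outside the fixed-point algebra, but [x i * y j] has degree [k + l = 0].
    Its adjoint can be cycled to the right of [a]; summing over [j] and then over [i] leaves [1]. *)
Lemma trace_compress2 (t : trace_space (fixed_alg g)) k l n m
    (x : 'I_n -> A) (y : 'I_m -> A) a :
  k + l = 0 -> row_frame k x -> row_frame l y -> ssub 0 a ->
  t (fix_part (compress y (compress x a))) = t (fix_part a).
Proof.
move=> kl xk yl a0; have [hx x1] := xk; have [hy y1] := yl.
have xy0 i j : ssub 0 (x i * y j) by rewrite -kl; exact: ssubM.
have ca0 : ssub 0 (compress x a) := ssub_compress xk a0.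
rewrite /compress trace_fix_sum; last by move=> j; exact: (ssub_entry yl).
transitivity (\sum_(j < m) \sum_(i < n)
    t (fix_part (a * (x i * y j * (star (y j) * star (x i)))))).
  apply: eq_bigr => j _; rewrite mulr_sumr mulr_suml trace_fix_sum; last first.
    move=> i; rewrite -!mulrA mulrA -starM; have := ssub_star (xy0 i j).
    rewrite oppr0 => h.
    by have := ssubM h (ssubM a0 (xy0 i j)); rewrite !addr0 !mulrA.
  apply: eq_bigr => i _; have := ssub_star (xy0 i j); rewrite oppr0 => h.
  rewrite -starM !mulrA -[a * _ * _]mulrA -trace_fix_comm//.
    by rewrite starM !mulrA.
  by have := ssubM a0 (xy0 i j); rewrite addr0.
have s0 i j : ssub 0 (a * (x i * y j * (star (y j) * star (x i)))).
  have := ssub_star (xy0 i j); rewrite oppr0 starM => h.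
  by have := ssubM a0 (ssubM (xy0 i j) h); rewrite !addr0.
rewrite exchange_big /=.
under eq_bigr => i _ do rewrite -trace_fix_sum//.
rewrite -trace_fix_sum; last by move=> i; exact: ssub_sum.
congr (t (fix_part _)).
under eq_bigr => i _.
  rewrite -mulr_sumr (_ : \sum_(j < m) _ = x i * star (x i)); last first.
    transitivity (x i * (\sum_(j < m) y j * star (y j)) * star (x i)).
      by rewrite mulr_sumr mulr_suml; apply: eq_bigr => j _; rewrite !mulrA.
    by rewrite y1 mulr1.
  over.
by rewrite -mulr_sumr x1 mulr1.
Qed.

(** Fullness gives [v], a sum of [x i * star (z i)], within 1/2 of [1]. Polarising replaces it by
    [h], a sum of [(x i + z i) * star (x i + z i)] dominating the scalar 2; its inverse root in the
    fixed-point algebra then normalises the family without changing degrees. *)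
Lemma row_frame_exists k : full g -> exists n (x : 'I_n -> A), row_frame k x.
Proof.
move=> gf; have one0 : ssub 0 1 := fixed_valP (1 : fixed_alg g).
have Bc := fixed_alg_cauchy_complete; have Ac := cstar_cauchy_complete.
have [v [[n [c [w [hw vE]]]] v1]] : exists v, lin_span [set x * y | x in ssub k
    & y in ssub (- k)] v /\ cnorm (1 - v) <= 1 / 2.
  have := one0; rewrite -(gf k) => /(_ (ball (1 : normed_space A) (1 / 2)%:C)) [].
    by apply: nbhsx_ballx; rewrite (ltcR 0) divr_gt0.
  move=> v [vs]; rewrite -ball_normE /= [ltLHS]/(_%:C) ltcR => h.
  by exists v; split => //; exact: ltW.
have /choice[xy hxy] i : exists p : A * A,
    [/\ ssub k p.1, ssub k p.2 & c i *: w i = p.1 * star p.2].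
  have [x xk [y yk <-]] := hw i.
  exists (c i *: x, star y); split => /=; first exact: ssub_scale.
    by rewrite -[k]opprK; exact: ssub_star.
  by rewrite starK scalerAl.
pose x i := (xy i).1; pose z i := (xy i).2.
have xk i : ssub k (x i) by case: (hxy i).
have zk i : ssub k (z i) by case: (hxy i).
have {}vE : v = \sum_(i < n) x i * star (z i).
  by rewrite vE; apply: eq_bigr => i _; case: (hxy i).
pose h := \sum_(i < n) (x i + z i) * star (x i + z i).
have h0 : ssub 0 h.
  apply: ssub_sum => i; rewrite -(subrr k); apply: ssubM; first exact: ssubD.
  by apply: ssub_star; exact: ssubD.
pose q := \sum_(i < n) (x i - z i) * star (x i - z i).
pose d := (v - 1) + star (v - 1).
(* Polarisation gives [h = 2 (v + star v) + q] with [q] positive, and [v + star v = 2 + d]. Since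
   [cnorm d <= 1], the part [1 + d] is positive as well. *)
have hE : h = 2%:C%:A + (2%:C *: (1%:C%:A + d) + q).
  have -> : 2%:C *: (1%:C%:A + d) = 2%:C *: (v + star v) - 2%:C%:A.
    rewrite -scalerBr; congr (_ *: _); rewrite /d starB star1 scale1r.
    by rewrite addrA [1 + _]addrC subrK addrA.
  rewrite addrA [X in X + q]addrC subrK.
  rewrite vE star_sum -big_split scaler_sumr -big_split /=.
  apply: eq_bigr => i _; rewrite starD starB starM starK.
  rewrite (_ : 2%:C = 1 + 1) ?scalerDl ?scale1r//; last by rewrite rmorphD.
  rewrite !mulrDr !mulrDl !mulrN !mulNr.
  move: (x i * star (x i)) (x i * star (z i)) (z i * star (x i)) (z i * star (z i)).
  move=> a b e f; rewrite opprK.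
  by rewrite !addrA [RHS](ACl (5*2*1*8*4*6*3*7)%AC)/= !addrK.
have pa : pos (fix_part h - 2%:C%:A).
  have e : fixed_val (fix_part h - 2%:C%:A) = h - 2%:C%:A.
    by rewrite -[in RHS](fix_partK h0).
  apply/pos_fixed_val; rewrite e hE addrC addKr; apply: posD; last first.
    by apply: pos_sum => i; exact: mul_star_pos.
  apply: posZ => //; apply: pos_scalarD; first by rewrite /d starD starK addrC.
  rewrite (le_trans (cnormD_le _ _))// cnorm_star cnorm_distC; lra.
have [r rh rhr] := pos_add_scalar_inv_sqrt Bc pa (ltr0n R 2).
exists n, (fun i => fixed_val r * (x i + z i)); split.
  move=> i; rewrite -[k]add0r; apply: ssubM; [exact: fixed_valP|exact: ssubD].
transitivity (fixed_val r * h * fixed_val r).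
  rewrite mulr_sumr mulr_suml; apply: eq_bigr => i _.
  by rewrite starM -fixed_val_star rh !mulrA.
have := congr1 (@fixed_val _ _ g) rhr.
by rewrite addrC subrK !fixed_valM fix_partK.
Qed.

End Completeness.

Section InverseShift.
Context {R : realType} {A : cstarAlgType R}.
Variable g : circle_action A.

Let tnth_frame (xs : seq A) : row_family g xs -> row_frame g 1 (tnth (in_tuple xs)).
Proof.
move=> [xs1 x1]; split=> [i|]; first by apply: xs1; exact: mem_tnth.
by rewrite -[RHS]x1 [RHS]big_tnth.
Qed.

Lemma dual_shift_extremal_eigenstates (xs : seq A) (hxs : row_family g xs) :
  full g -> (exists t : trace_space (fixed_alg g), tracial_state t) ->
  exists rmin rmax : R[i],
    [/\ is_rmin (dual_shift hxs) rmin, is_rmax (dual_shift hxs) rmax,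
        exists2 t1, tracial_state t1 & dual_shift hxs t1 = rmin *: t1
      & exists2 t2, tracial_state t2 & dual_shift hxs t2 = rmax *: t2].
Proof.
move=> gf st; have xk := tnth_frame hxs.
have [n [y yk]] := row_frame_exists (-1) gf.
have compE a : compression hxs a = fix_compress (tnth (in_tuple xs)) a.
  by apply: fixed_val_inj; rewrite fixed_val_compression (fix_compressE xk) [LHS]big_tnth.
have SE t a : dual_shift hxs t a = t (fix_compress (tnth (in_tuple xs)) a).
  by rewrite dual_shiftE compE.
pose S' t := mk_trace (compress_trace yk t).
have SE' t a : S' t a = t (fix_compress y a) by [].
apply: (extremal_eigenstates (@fixed_alg_cauchy_complete _ _ g) SE _ SE') => //.
- move=> t tp a pa; rewrite SE; apply: tp; exact: (fix_compress_pos xk).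
- move=> t tp a pa; rewrite SE'; apply: tp; exact: (fix_compress_pos yk).
- move=> t; apply: trace_ext => a; rewrite SE' SE {1}/fix_compress (fix_compressE yk).
  by rewrite (trace_compress2 t _ yk xk)// ?fixed_valK//; exact: fixed_valP.
- move=> t; apply: trace_ext => a; rewrite SE SE' {1}/fix_compress (fix_compressE xk).
  by rewrite (trace_compress2 t _ xk yk)// ?fixed_valK//; exact: fixed_valP.
Qed.

Lemma row_family_exists : full g -> exists xs : seq A, row_family g xs.
Proof.
move=> /(row_frame_exists 1)[n [x [x1 xx]]].
exists [seq x i | i <- enum 'I_n]; split; first by move=> _ /mapP[i _ ->].
by rewrite big_map big_enum.
Qed.

End InverseShift.

(** The first conjunct keeps the quantification over families in the second from being vacuous;
    treating every family covers any choice of [{x_j}]. *)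
Theorem theorem2p5 (R : realType) (A : cstarAlgType R) (g : circle_action A) :
  full g ->
  (exists t : trace_space (fixed_alg g), tracial_state t) ->
  (exists xs : seq A, row_family g xs) /\
  forall (xs : seq A) (hxs : row_family g xs),
    exists rmin rmax : R[i],
      [/\ is_rmin (dual_shift hxs) rmin,
          is_rmax (dual_shift hxs) rmax,
          exists2 t1 : trace_space (fixed_alg g),
            tracial_state t1 & dual_shift hxs t1 = rmin *: t1
        & exists2 t2 : trace_space (fixed_alg g),
            tracial_state t2 & dual_shift hxs t2 = rmax *: t2].
Proof.
move=> gf st; split; first exact: row_family_exists.
by move=> xs hxs; exact: dual_shift_extremal_eigenstates.
Qed.
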